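(* Let $M={}_{f_2}M_1\times_{f_1}M_2$ with metric $g$ be a doubly warped product manifold whose first factor manifold $M_1$ is compact. If the function $k=\ln f_1$ (pulled back to $M$) is harmonic with respect to the Laplacian $\Delta$ of $(M,g)$, i.e. $\Delta k=0$ on $M$, then $M$ is a warped product manifold of the form ${}_{f_2}M_1\times M_2$.
   Context: Let $(M_1,g_1)$ and $(M_2,g_2)$ be Riemannian manifolds, let $f_1$ and $f_2$ be positive smooth functions on $M_1$ and $M_2$ respectively, and let $\pi_i:M_1\times M_2\to M_i$ be the canonical projections. The doubly warped product manifold ${}_{f_2}M_1\times_{f_1}M_2$ is $M_1\times M_2$ equipped with the metric $g=(f_2\circ\pi_2)^2\pi_1^*(g_1)+(f_1\circ\pi_1)^2\pi_2^*(g_2)$. Put $k=\ln f_1$ and $l=\ln f_2$; the same symbols denote the pullbacks $k\circ\pi_1$, $l\circ\pi_2$ to $M$. The Laplacian $\Delta$ is the trace with respect to $g$ of the Hessian of $(M,g)$. ''$M$ is a warped product manifold of the form ${}_{f_2}M_1\times M_2$'' means that $f_1$ is a constant $c_1$, so that $g=f_2^2g_1\oplus\tilde g_2$ with $\tilde g_2=c_1^2g_2$.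
   Formalization: The first factor M_1 is additionally assumed connected; without this the claim fails (M_1 two disjoint circles, f_1 equal to different constants on them, so that k is harmonic but f_1 is not constant). *)

(* Defs.v *)
From HB Require Import structures.
From mathcomp Require Import all_boot all_order all_algebra.
From mathcomp Require Import all_classical all_reals all_analysis.

Set Implicit Arguments.
Unset Strict Implicit.
Unset Printing Implicit Defensive.

Import Order.TTheory GRing.Theory Num.Theory numFieldNormedType.Exports.

Local Open Scope classical_set_scope.
Local Open Scope ring_scope.

Section smooth.
Context {R : realType}.

Definition partial n (i : 'I_n) (f : 'rV[R]_n -> R) : 'rV[R]_n -> R :=
  fun x => 'D_(delta_mx 0 i) f x.

Definition partials n (s : seq 'I_n) (f : 'rV[R]_n -> R) : 'rV[R]_n -> R :=
  foldr (@partial n) f s.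

(* C^oo on an open set: the partial derivatives of all orders exist and are
   (Frechet) differentiable, hence continuous, on it. *)
Definition smooth_on n (U : set 'rV[R]_n) (f : 'rV[R]_n -> R) :=
  forall s x, U x -> differentiable (partials s f) x.

Definition smooth_map_on n m (U : set 'rV[R]_n) (f : 'rV[R]_n -> 'rV[R]_m) :=
  forall j, smooth_on U (fun x => f x 0 j).

End smooth.

(* A homeomorphism between an open set [cdom] of T and an open set [cimg] of
   R^n; the values of [cmap] and [cinv] outside these sets are irrelevant. *)
Record chart (R : realType) (n : nat) (T : topologicalType) := Chart {
  cdom : set T;
  cimg : set 'rV[R]_n;
  cmap : T -> 'rV[R]_n;
  cinv : 'rV[R]_n -> T;
  open_cdom : open cdom;
  open_cimg : open cimg;
  cmap_img : forall p, cdom p -> cimg (cmap p);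
  cinv_dom : forall x, cimg x -> cdom (cinv x);
  cmapK : forall p, cdom p -> cinv (cmap p) = p;
  cinvK : forall x, cimg x -> cmap (cinv x) = x;
  cmap_continuous : forall p, cdom p -> {for p, continuous cmap};
  cinv_continuous : forall x, cimg x -> {for x, continuous cinv} }.

Record manifold (R : realType) (n : nat) := Manifold {
  mcarrier :> topologicalType;
  cidx : Type;
  mchart : cidx -> chart R n mcarrier;
  manifold_nonempty : [set: mcarrier] !=set0;
  manifold_hausdorff : hausdorff_space mcarrier;
  manifold_second_countable : @second_countable mcarrier;
  manifold_cover : forall p, exists i, cdom (mchart i) p;
  manifold_transition : forall i j,
    smooth_map_on (cimg (mchart i) `&` cinv (mchart i) @^-1` cdom (mchart j))
      (cmap (mchart j) \o cinv (mchart i)) }.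

Section geometry.
Context {R : realType}.

Definition smooth n (M : manifold R n) (u : M -> R) :=
  forall i : cidx M, smooth_on (cimg (mchart i)) (u \o cinv (mchart i)).

(* Matrix of the differential of F at p in the chart i of M and the chart j of
   N, acting on row vectors. *)
Definition local_jacobian m n (M : manifold R m) (N : manifold R n)
    (F : M -> N) (i : cidx M) (j : cidx N) (p : M) : 'M[R]_(m, n) :=
  'J (cmap (mchart j) \o F \o cinv (mchart i)) (cmap (mchart i) p).

(* Covariant 2-tensor fields are given by their components: [h i p] is the matrix
   of the bilinear form h_p in the coordinate frame of the chart i, relevant only
   for p in the domain of that chart. [pullback F h i j p] is the matrix of F^* h
   at p in the chart i of M, with h read in the chart j of N around F p. *)
Definition pullback m n (M : manifold R m) (N : manifold R n)
    (F : M -> N) (h : cidx N -> N -> 'M[R]_n) (i : cidx M) (j : cidx N) (p : M) : 'M[R]_m :=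
  local_jacobian F i j p *m h j (F p) *m (local_jacobian F i j p)^T.

Record metric n (M : manifold R n) := Metric {
  mcomp :> cidx M -> M -> 'M[R]_n;
  metric_sym : forall i p, cdom (mchart i) p -> (mcomp i p)^T = mcomp i p;
  metric_pos : forall i p, cdom (mchart i) p ->
    forall v : 'rV[R]_n, v != 0 -> 0 < (v *m mcomp i p *m v^T) 0 0;
  metric_transition : forall i j p,
    cdom (mchart i) p -> cdom (mchart j) p ->
    mcomp i p = pullback idfun mcomp i j p;
  metric_smooth : forall i a b,
    smooth_on (cimg (mchart i)) (fun x => mcomp i (cinv (mchart i) x) a b) }.

Section coordinates.
Context {n : nat} (G : 'rV[R]_n -> 'M[R]_n).

Definition christoffel (c a b : 'I_n) (x : 'rV[R]_n) : R :=
  2^-1 * \sum_d invmx (G x) c d *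
    (partial a (fun y => G y d b) x + partial b (fun y => G y d a) x
     - partial d (fun y => G y a b) x).

Definition local_hessian (u : 'rV[R]_n -> R) (x : 'rV[R]_n) : 'M[R]_n :=
  \matrix_(a, b)
    (partial a (partial b u) x - \sum_c christoffel c a b x * partial c u x).

Definition local_laplacian (u : 'rV[R]_n -> R) (x : 'rV[R]_n) : R :=
  \tr (invmx (G x) *m local_hessian u x).

End coordinates.

(* The Laplacian of u at p, computed in the chart i around p; it does not depend
   on i, since the Hessian is a tensor. *)
Definition laplacian n (M : manifold R n) (g : metric M) (u : M -> R)
    (i : cidx M) (p : M) : R :=
  local_laplacian (fun x => g i (cinv (mchart i) x)) (u \o cinv (mchart i))
    (cmap (mchart i) p).

Definition harmonic_on_manifold n (M : manifold R n) (g : metric M) (u : M -> R) :=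
  forall i p, cdom (mchart i) p -> laplacian g u i p = 0.

Record pos_smooth n (M : manifold R n) := PosSmooth {
  psfun :> M -> R;
  ps_gt0 : forall p, 0 < psfun p;
  ps_smooth : smooth psfun }.

End geometry.


Section smooth_lemmas.
Context {R : realType}.

Lemma differentiable_near (V W : normedModType R) (f g : V -> W) (x : V) :
  (\near x, f x = g x) -> differentiable f x -> differentiable g x.
Proof.
move=> fg /diff_locallyP[dfc dxf].
have gx : g x = f x by rewrite (nbhs_singleton fg).
have H : g \o shift x = cst (g x) + 'd f x +o_ 0 id.
  apply/eqaddoP => _/posnumP[e].
  move/eqaddoP/(_ e%:num (gt0 e)) : dxf.
  apply: filter_app.
  move: fg; rewrite (near_shift 0 x) subr0 => fg.
  near=> y => /=.
  rewrite !fctE/= gx.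
  suff -> : f (y + x) = g (y + x) by [].
  by near: y.
apply/diffP.
apply: (@getPex _ (fun (df : {linear V -> W}) => continuous df /\
  forall y, g y = g (lim (nbhs x)) + df (y - lim (nbhs x))
                  +o_(y \near x) (y - lim (nbhs x)))).
exists ('d f x); split => //.
apply: eqaddoEx => y; rewrite lim_id //.
move: H => /eqaddoP H.
rewrite -[in LHS](subrK x y).
have -> : g (y - x + x) = (g \o shift x) (y - x) by [].
have {}H := (eqaddoP _ _ _ _).2 H.
rewrite H [in LHS]/=.
rewrite !fctE; congr (_ + _).
rewrite -(comp_centerK x id) -[X in the_littleo _ _ _ X](comp_centerK x).
by rewrite -[_ (y - x)]/((_ \o (center x)) y) -littleo_center0.
Unshelve. all: by end_near. Qed.

Lemma near_open n (U : set 'rV[R]_n) (f g : 'rV[R]_n -> R) x :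
  open U -> U x -> {in U, f =1 g} -> \near x, f x = g x.
Proof.
move=> oU Ux fg; have : nbhs x U by exact: open_nbhs_nbhs.
by apply: filterS => y Uy; apply: fg; rewrite inE.
Qed.

Lemma partials_eq n (U : set 'rV[R]_n) (f g : 'rV[R]_n -> R) s :
  open U -> {in U, f =1 g} -> {in U, partials s f =1 partials s g}.
Proof.
move=> oU fg; elim: s => //= i s IH x; rewrite inE => Ux.
by apply: near_eq_derive; apply: near_open IH.
Qed.

Lemma smooth_on_eq n (U : set 'rV[R]_n) (f g : 'rV[R]_n -> R) :
  open U -> {in U, f =1 g} -> smooth_on U f -> smooth_on U g.
Proof.
move=> oU fg sf s x Ux; apply: differentiable_near (sf s x Ux).
by apply: near_open (partials_eq _ oU fg).
Qed.

Lemma smooth_onS n (U V : set 'rV[R]_n) (f : 'rV[R]_n -> R) :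
  U `<=` V -> smooth_on V f -> smooth_on U f.
Proof. by move=> UV sf s x /UV; apply: sf. Qed.

Lemma smooth_on_partial n (U : set 'rV[R]_n) i (f : 'rV[R]_n -> R) :
  smooth_on U f -> smooth_on U (partial i f).
Proof. by move=> sf s x /(sf (rcons s i)); rewrite /partials foldr_rcons. Qed.

Lemma partials_cst0 n (s : seq 'I_n) :
  partials s (fun=> 0 : R) = (fun=> 0) :> ('rV[R]_n -> R).
Proof.
elim: s => //= i s IH; rewrite IH; apply/funext => x.
by rewrite /partial derive_cst.
Qed.

Lemma smooth_on_cst n (U : set 'rV[R]_n) (c : R) : smooth_on U (fun=> c).
Proof.
move=> s x _; case: (lastP s) => [|{}s i]; first exact: differentiable_cst.
rewrite /partials foldr_rcons -/(partials s _).
have -> : partial i (fun=> c) = (fun=> 0) :> ('rV[R]_n -> R).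
  by apply/funext => y; rewrite /partial derive_cst.
by rewrite partials_cst0; exact: differentiable_cst.
Qed.

Local Definition diff_upto n k (U : set 'rV[R]_n) (f : 'rV[R]_n -> R) :=
  forall s x, (size s <= k)%N -> U x -> differentiable (partials s f) x.

Lemma partialsD n k (U : set 'rV[R]_n) (f g : 'rV[R]_n -> R) s : open U ->
  diff_upto k U f -> diff_upto k U g -> (size s <= k)%N ->
  {in U, partials s (f \+ g) =1 partials s f \+ partials s g}.
Proof.
move=> oU sf sg; elim: s => //= i s IH sk x xU.
have Ux : U x by rewrite inE in xU.
rewrite /partial.
transitivity ('D_(delta_mx 0 i) (partials s f \+ partials s g) x).
  by apply: near_eq_derive; apply: (near_open oU Ux); apply: IH; exact: ltnW.
by rewrite /= deriveD//; apply/diff_derivable; [apply: sf|apply: sg] => //;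
  exact: ltnW.
Qed.

Lemma diff_uptoD n k (U : set 'rV[R]_n) (f g : 'rV[R]_n -> R) : open U ->
  diff_upto k U f -> diff_upto k U g -> diff_upto k U (f \+ g).
Proof.
move=> oU sf sg s x sk Ux.
have : differentiable (partials s f \+ partials s g) x.
  by apply: differentiableD; [exact: sf|exact: sg].
apply: differentiable_near; apply: (near_open oU Ux) => y yU.
by rewrite (partialsD oU sf sg sk yU).
Qed.

Lemma smooth_onD n (U : set 'rV[R]_n) (f g : 'rV[R]_n -> R) : open U ->
  smooth_on U f -> smooth_on U g -> smooth_on U (f \+ g).
Proof.
move=> oU sf sg s x; apply: (@diff_uptoD _ (size s)) => // t y _; [exact: sf|exact: sg].
Qed.

Lemma smooth_onM n (U : set 'rV[R]_n) (f g : 'rV[R]_n -> R) : open U ->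
  smooth_on U f -> smooth_on U g -> smooth_on U (fun x => f x * g x).
Proof.
move=> oU sf sg.
suff H k : diff_upto k U (fun x => f x * g x) by move=> s x; exact: (H (size s)).
elim: k f g sf sg => [|k IH] f g sf sg s x; case/lastP: s => [|s i].
- by move=> _ Ux; apply: differentiableM; [exact: (sf [::])|exact: (sg [::])].
- by rewrite size_rcons.
- by move=> _ Ux; apply: differentiableM; [exact: (sf [::])|exact: (sg [::])].
rewrite size_rcons ltnS => sk Ux.
rewrite /partials foldr_rcons -/(partials s _).
set u := fun x => f x * partial i g x.
set v := fun x => g x * partial i f x.
have E : {in U, u \+ v =1 partial i (fun x => f x * g x)}.
  move=> y; rewrite inE => Uy; rewrite /partial.
  rewrite deriveM//; first exact/diff_derivable/(sf [::]).
  exact/diff_derivable/(sg [::]).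
have suv : diff_upto k U (u \+ v).
  by apply: diff_uptoD => //; apply: IH => //; exact: smooth_on_partial.
apply: differentiable_near (suv s x sk Ux).
by apply: (near_open oU Ux); exact: partials_eq.
Qed.

Lemma derive_lin n m (L : {linear 'rV[R]_n -> 'rV[R]_m}) (f : 'rV[R]_m -> R) x v :
  'D_v (f \o L) x = 'D_(L v) f (L x).
Proof.
have H : (fun h => h^-1 *: (((f \o L) \o shift x) (h *: v) - (f \o L) x)) =
    (fun h => h^-1 *: ((f \o shift (L x)) (h *: L v) - f (L x))) :> (R -> R).
  by apply/funext => h /=; rewrite linearP.
by rewrite /derive H.
Qed.

Lemma smooth_on_lin n m (L : {linear 'rV[R]_n -> 'rV[R]_m})
    (e : 'I_n -> option 'I_m) (U : set 'rV[R]_m) (f : 'rV[R]_m -> R) :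
  continuous L ->
  (forall i, L (delta_mx 0 i) = if e i is Some j then delta_mx 0 j else 0) ->
  smooth_on U f -> smooth_on (L @^-1` U) (f \o L).
Proof.
move=> Lc Le sf s x Ux.
have [[s' ->]|->] : (exists s', partials s (f \o L) = partials s' f \o L) \/
    partials s (f \o L) = (fun=> 0).
  elim: s => /= [|i s [[s' ->]|->]]; first by left; exists [::].
    case Ei : (e i) => [j|]; [left; exists (j :: s')|right]; apply/funext => y;
      by rewrite /= /partial derive_lin Le Ei// derive0.
  by right; apply/funext => y; rewrite /partial derive_cst.
  apply: differentiable_comp; first exact: linear_differentiable.
  exact: sf.
exact: differentiable_cst.
Qed.

Lemma lsubmx_delta n1 n2 (i : 'I_(n1 + n2)) :
  lsubmx (delta_mx 0 i : 'rV[R]__) =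
    if fintype.split i is inl j then delta_mx 0 j else 0.
Proof.
apply/rowP => k; rewrite !mxE; case: splitP => j ij; rewrite !mxE eqxx /=.
  by congr (_%:R); rewrite -val_eqE /= ij val_eqE.
by rewrite -val_eqE /= ij ltn_eqF// (leq_trans (ltn_ord k))// leq_addr.
Qed.

Lemma rsubmx_delta n1 n2 (i : 'I_(n1 + n2)) :
  rsubmx (delta_mx 0 i : 'rV[R]__) =
    if fintype.split i is inr j then delta_mx 0 j else 0.
Proof.
apply/rowP => k; rewrite !mxE; case: splitP => j ij; rewrite !mxE eqxx /=.
  by rewrite -val_eqE /= ij gtn_eqF// (leq_trans (ltn_ord j))// leq_addr.
by congr (_%:R); rewrite -val_eqE /= ij eqn_add2l val_eqE.
Qed.

Lemma smooth_on_lsubmx n1 n2 (U : set 'rV[R]_n1) (f : 'rV[R]_n1 -> R) :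
  smooth_on U f ->
  smooth_on (lsubmx @^-1` U) (f \o lsubmx : 'rV[R]_(n1 + n2) -> R).
Proof.
apply: (@smooth_on_lin _ _ lsubmx
  (fun i => if fintype.split i is inl j then Some j else None)).
  exact: continuous_lsubmx.
by move=> i; rewrite [LHS]lsubmx_delta; case: fintype.split => j.
Qed.

Lemma smooth_on_rsubmx n1 n2 (U : set 'rV[R]_n2) (f : 'rV[R]_n2 -> R) :
  smooth_on U f ->
  smooth_on (rsubmx @^-1` U) (f \o rsubmx : 'rV[R]_(n1 + n2) -> R).
Proof.
apply: (@smooth_on_lin _ _ rsubmx
  (fun i => if fintype.split i is inr j then Some j else None)).
  exact: continuous_rsubmx.
by move=> i; rewrite [LHS]rsubmx_delta; case: fintype.split => j.
Qed.

End smooth_lemmas.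

Section jacobian_lemmas.
Context {R : realType}.

Lemma continuous_rV (T : topologicalType) n (f : T -> 'rV[R]_n) p :
  (forall j, {for p, continuous (fun x => f x 0 j)}) -> {for p, continuous f}.
Proof.
move=> fc; apply/cvgrPdist_le => /= e e0; near=> x.
rewrite /Num.Def.normr/= mx_normrE (bigmax_le _ (ltW e0))//= => -[i j] _ /=.
rewrite !mxE ord1; move: j; near: x; apply: filter_forall => j.
exact: ((cvgrPdist_le _ _).1 (fc j)).
Unshelve. all: by end_near. Qed.

Lemma differentiable_rV (V : normedModType R) n (f : V -> 'rV[R]_n) x :
  (forall j, differentiable (fun y => f y 0 j) x) -> differentiable f x.
Proof.
move=> fd; have -> : f = \sum_(j < n) (fun y => f y 0 j *: delta_mx 0 j).
  by apply/funext => y; rewrite fct_sumE [LHS]row_sum_delta.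
apply: differentiable_sum => j; exact: differentiableZl.
Qed.

Lemma jacobian_comp m n k (f : 'rV[R]_m -> 'rV[R]_n) (g : 'rV[R]_n -> 'rV[R]_k) x :
  differentiable f x -> differentiable g (f x) ->
  'J (g \o f) x = 'J f x *m 'J g (f x).
Proof.
move=> fd gd; apply/row_matrixP => i; rewrite !rowE mulmxA.
by rewrite !mul_rV_lin1 diff_comp.
Qed.

Lemma jacobian_lin m n (L : {linear 'rV[R]_m -> 'rV[R]_n}) x :
  continuous L -> 'J L x = lin1_mx L.
Proof.
by move=> Lc; apply/row_matrixP => i; rewrite !rowE !mul_rV_lin1 diff_lin.
Qed.

Lemma jacobian_near m n (f g : 'rV[R]_m -> 'rV[R]_n) x :
  (\near x, f x = g x) -> differentiable f x -> 'J f x = 'J g x.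
Proof.
move=> fg fd; have gd := differentiable_near fg fd.
apply/row_matrixP => i; rewrite [LHS]rowE [RHS]rowE.
have Ef := deriveEjacobian (delta_mx 0 i) fd.
have Eg := deriveEjacobian (delta_mx 0 i) gd.
have Efg := near_eq_derive (delta_mx 0 i) fg.
exact: etrans (esym Ef) (etrans Efg Eg).
Qed.

Lemma smooth_map_differentiable m n (U : set 'rV[R]_m) (f : 'rV[R]_m -> 'rV[R]_n) x :
  smooth_map_on U f -> U x -> differentiable f x.
Proof. by move=> sf Ux; apply: differentiable_rV => j; exact: (sf j [::]). Qed.

Lemma smooth_on_sum n (I : Type) (r : seq I) (U : set 'rV[R]_n)
    (f : I -> 'rV[R]_n -> R) : open U ->
  (forall i, smooth_on U (f i)) -> smooth_on U (fun x => \sum_(i <- r) f i x).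
Proof.
move=> oU sf; elim: r => [|i r IH].
  under [X in smooth_on U X]eq_fun do rewrite big_nil.
  exact: smooth_on_cst.
under [X in smooth_on U X]eq_fun do rewrite big_cons.
exact: smooth_onD.
Qed.

Lemma smooth_on_conj n m k (U : set 'rV[R]_n) (A B : 'M[R]_(k, m))
    (h : 'rV[R]_n -> 'M[R]_m) a b : open U ->
  (forall c d, smooth_on U (fun x => h x c d)) ->
  smooth_on U (fun x => (A *m h x *m B^T) a b).
Proof.
move=> oU sh; under [X in smooth_on U X]eq_fun do rewrite mxE.
apply: smooth_on_sum => // d; apply: smooth_onM => //; last exact: smooth_on_cst.
under [X in smooth_on U X]eq_fun do rewrite mxE.
by apply: smooth_on_sum => // c; apply: smooth_onM => //; exact: smooth_on_cst.
Qed.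

Lemma open_overlap n (T : topologicalType) (c : chart R n T) (U : set T) :
  open U -> open (cimg c `&` cinv c @^-1` U).
Proof.
move=> oU; rewrite openE => x [cx Ux]; apply: filterI.
  by apply: open_nbhs_nbhs; split => //; exact: open_cimg.
exact: (cinv_continuous cx (open_nbhs_nbhs (conj oU Ux))).
Qed.

End jacobian_lemmas.

Section product_topology.
Context (T U : topologicalType).

Lemma open_rect (A : set T) (B : set U) : open A -> open B -> open (A `*` B).
Proof.
move=> oA oB; rewrite openE => -[x y] [/= Ax By].
by exists (A, B) => //=; split; exact: open_nbhs_nbhs.
Qed.

Lemma hausdorff_prod :
  hausdorff_space T -> hausdorff_space U -> hausdorff_space (T * U)%type.
Proof.
move=> hT hU [x1 x2] [y1 y2] H; congr pair; [apply: hT|apply: hU] => A B xA yB.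
  have [||[z1 z2] [[/= Az _] [/= Bz _]]] := H (A `*` setT) (B `*` setT);
    last by exists z1.
    by exists (A, setT) => //=; split => //; exact: filterT.
  by exists (B, setT) => //=; split => //; exact: filterT.
have [||[z1 z2] [[/= _ Az] [/= _ Bz]]] := H (setT `*` A) (setT `*` B);
  last by exists z2.
  by exists (setT, A) => //=; split => //; exact: filterT.
by exists (setT, B) => //=; split => //; exact: filterT.
Qed.

Lemma second_countable_prod :
  @second_countable T -> @second_countable U ->
  @second_countable (T * U)%type.
Proof.
move=> [A cA [oA bA]] [B cB [oB bB]].
exists ((fun P : set T * set U => P.1 `*` P.2) @` (A `*` B)).
  apply: card_le_trans (countableX cA cB); exact: card_image_le.
split.
  by move=> _ [[P Q] [/= /oA oP /oB oQ] <-]; exact: open_rect.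
move=> [x y] W [[P Q] [/= xP yQ] PQW].
have [P' [AP' P'x] P'P] := bA x P xP.
have [Q' [BQ' Q'y] Q'Q] := bB y Q yQ.
exists (P' `*` Q'); first by split => //=; exists (P', Q').
by move=> [u v] [/= /P'P ? /Q'Q ?]; exact: PQW.
Qed.

End product_topology.

Section product_manifold.
Context {R : realType}.

Section product_chart.
Context {n1 n2 : nat} {T1 T2 : topologicalType}.
Variables (c1 : chart R n1 T1) (c2 : chart R n2 T2).

Definition prod_cdom : set (T1 * T2) := cdom c1 `*` cdom c2.

Definition prod_cimg : set 'rV[R]_(n1 + n2) :=
  lsubmx @^-1` cimg c1 `&` rsubmx @^-1` cimg c2.

Definition prod_cmap (p : T1 * T2) : 'rV[R]_(n1 + n2) :=
  row_mx (cmap c1 p.1) (cmap c2 p.2).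

Definition prod_cinv (x : 'rV[R]_(n1 + n2)) : T1 * T2 :=
  (cinv c1 (lsubmx x), cinv c2 (rsubmx x)).

Lemma open_prod_cimg : open prod_cimg.
Proof.
apply: openI.
  by apply: open_comp; [move=> x _; exact: continuous_lsubmx|exact: open_cimg].
by apply: open_comp; [move=> x _; exact: continuous_rsubmx|exact: open_cimg].
Qed.

Lemma prod_cmap_continuous p : prod_cdom p -> {for p, continuous prod_cmap}.
Proof.
case: p => p1 p2 [/= d1 d2]; apply: continuous_rV => j.
rewrite -[j]splitK; case: (fintype.split j) => k /=.
  have -> : (fun x => prod_cmap x 0 (lshift n2 k)) =
      (fun u => u 0 k) \o (cmap c1 \o fst).
    by apply/funext => x; rewrite /= row_mxEl.
  have H : {for (p1, p2), continuous (cmap c1 \o fst)}.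
    have cf : {for (p1, p2), continuous (@fst T1 T2)} by exact: cvg_fst.
    exact: (continuous_comp cf (cmap_continuous d1)).
  exact: (continuous_comp H (@coord_continuous _ _ _ 0 k _)).
have -> : (fun x => prod_cmap x 0 (rshift n1 k)) =
    (fun u => u 0 k) \o (cmap c2 \o snd).
  by apply/funext => x; rewrite /= row_mxEr.
have H : {for (p1, p2), continuous (cmap c2 \o snd)}.
  have cf : {for (p1, p2), continuous (@snd T1 T2)} by exact: cvg_snd.
  exact: (continuous_comp cf (cmap_continuous d2)).
exact: (continuous_comp H (@coord_continuous _ _ _ 0 k _)).
Qed.

Lemma prod_cinv_continuous x : prod_cimg x -> {for x, continuous prod_cinv}.
Proof.
move=> [/= d1 d2] W [[A B] [/= nA nB] ABW].
have cl : {for x, continuous (lsubmx : 'rV[R]_(n1 + n2) -> _)}.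
  exact: continuous_lsubmx.
have cr : {for x, continuous (rsubmx : 'rV[R]_(n1 + n2) -> _)}.
  exact: continuous_rsubmx.
have H1 := continuous_comp cl (cinv_continuous d1) nA.
have H2 := continuous_comp cr (cinv_continuous d2) nB.
have : nbhs x ((cinv c1 \o lsubmx) @^-1` A `&` (cinv c2 \o rsubmx) @^-1` B).
  exact: filterI.
by apply: filterS => y [/= ? ?]; exact: ABW.
Qed.

Lemma prod_cmap_img p : prod_cdom p -> prod_cimg (prod_cmap p).
Proof.
by move=> [? ?]; split; rewrite /= ?row_mxKl ?row_mxKr; exact: cmap_img.
Qed.

Lemma prod_cinv_dom x : prod_cimg x -> prod_cdom (prod_cinv x).
Proof. by move=> [? ?]; split; exact: cinv_dom. Qed.

Lemma prod_cmapK p : prod_cdom p -> prod_cinv (prod_cmap p) = p.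
Proof.
case: p => p1 p2 [/= d1 d2].
by rewrite /prod_cinv /prod_cmap row_mxKl row_mxKr !cmapK.
Qed.

Lemma prod_cinvK x : prod_cimg x -> prod_cmap (prod_cinv x) = x.
Proof.
by move=> [/= d1 d2]; rewrite /prod_cinv /prod_cmap /= !cinvK// hsubmxK.
Qed.

Definition prod_chart : chart R (n1 + n2) (T1 * T2)%type :=
  Chart (open_rect (open_cdom c1) (open_cdom c2)) open_prod_cimg
    prod_cmap_img prod_cinv_dom prod_cmapK prod_cinvK
    prod_cmap_continuous prod_cinv_continuous.

End product_chart.

Context {n1 n2 : nat} (M1 : manifold R n1) (M2 : manifold R n2).

Definition prod_mchart (i : cidx M1 * cidx M2) : chart R (n1 + n2) (M1 * M2)%type :=
  prod_chart (mchart i.1) (mchart i.2).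

Lemma prod_nonempty : [set: (M1 * M2)%type] !=set0.
Proof.
by have [x _] := manifold_nonempty M1; have [y _] := manifold_nonempty M2; exists (x, y).
Qed.

Lemma prod_cover p : exists i, cdom (prod_mchart i) p.
Proof.
have [i ip] := manifold_cover p.1; have [j jp] := manifold_cover p.2.
by exists (i, j).
Qed.

Lemma prod_transition i j :
  smooth_map_on (cimg (prod_mchart i) `&` cinv (prod_mchart i) @^-1` cdom (prod_mchart j))
    (cmap (prod_mchart j) \o cinv (prod_mchart i)).
Proof.
move=> a; rewrite -[a]splitK; case: (fintype.split a) => k /=.
  have -> : (fun x => (cmap (prod_mchart j) \o cinv (prod_mchart i)) x 0 (lshift n2 k)) =
      (fun y => (cmap (mchart j.1) \o cinv (mchart i.1)) y 0 k) \o lsubmx.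
    by apply/funext => x; rewrite /= row_mxEl.
  apply: smooth_onS (smooth_on_lsubmx (manifold_transition (i := i.1) (j := j.1) k)).
  by move=> x [[? _] [? _]]; split.
have -> : (fun x => (cmap (prod_mchart j) \o cinv (prod_mchart i)) x 0 (rshift n1 k)) =
    (fun y => (cmap (mchart j.2) \o cinv (mchart i.2)) y 0 k) \o rsubmx.
  by apply/funext => x; rewrite /= row_mxEr.
apply: smooth_onS (smooth_on_rsubmx (manifold_transition (i := i.2) (j := j.2) k)).
by move=> x [[_ ?] [_ ?]]; split.
Qed.

Definition prod_manifold : manifold R (n1 + n2) :=
  Manifold prod_nonempty
    (hausdorff_prod (@manifold_hausdorff _ _ M1) (@manifold_hausdorff _ _ M2))
    (second_countable_prod (@manifold_second_countable _ _ M1)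
       (@manifold_second_countable _ _ M2))
    prod_cover prod_transition.

End product_manifold.

Section warped_products.
Context {R : realType} {n1 n2 : nat}.
Context (M1 : manifold R n1) (M2 : manifold R n2).

Local Notation M := (prod_manifold M1 M2).

(* a^2 pi_1^*(g1) + b^2 pi_2^*(g2), in the product charts *)
Definition prod_tensor (a b : M -> R) (g1 : metric M1) (g2 : metric M2)
    (i : cidx M) (p : M) : 'M[R]_(n1 + n2) :=
  a p ^+ 2 *: pullback (M := M) (N := M1) fst g1 i i.1 p
  + b p ^+ 2 *: pullback (M := M) (N := M2) snd g2 i i.2 p.

Local Notation P1 := (lin1_mx lsubmx : 'M[R]_(n1 + n2, n1)).
Local Notation P2 := (lin1_mx rsubmx : 'M[R]_(n1 + n2, n2)).

Lemma local_jacobian_fst i p : cdom (mchart i) p ->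
  local_jacobian (M := M) (N := M1) fst i i.1 p = P1.
Proof.
move=> dp; rewrite -(jacobian_lin (cmap (mchart i) p) (@continuous_lsubmx _ _ _ _)).
apply/esym/jacobian_near; last exact: differentiable_lsubmx.
have : nbhs (cmap (mchart i) p) (cimg (mchart i)).
  by apply: open_nbhs_nbhs; split; [exact: open_cimg|exact: cmap_img].
by apply: filterS => x [/= dx _]; rewrite cinvK.
Qed.

Lemma local_jacobian_snd i p : cdom (mchart i) p ->
  local_jacobian (M := M) (N := M2) snd i i.2 p = P2.
Proof.
move=> dp; rewrite -(jacobian_lin (cmap (mchart i) p) (@continuous_rsubmx _ _ _ _)).
apply/esym/jacobian_near; last exact: differentiable_rsubmx.
have : nbhs (cmap (mchart i) p) (cimg (mchart i)).
  by apply: open_nbhs_nbhs; split; [exact: open_cimg|exact: cmap_img].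
by apply: filterS => x [/= _ dx]; rewrite cinvK.
Qed.

Lemma prod_tensorE a b g1 g2 i p : cdom (mchart i) p ->
  prod_tensor a b g1 g2 i p =
  a p ^+ 2 *: (P1 *m g1 i.1 p.1 *m P1^T) + b p ^+ 2 *: (P2 *m g2 i.2 p.2 *m P2^T).
Proof.
by move=> dp; rewrite /prod_tensor /pullback local_jacobian_fst ?local_jacobian_snd.
Qed.

Variables (g1 : metric M1) (g2 : metric M2).
Variables (f1 : pos_smooth M1) (f2 : pos_smooth M2).

(* (f2 o pi_2)^2 pi_1^*(g1) + (f1 o pi_1)^2 pi_2^*(g2) *)
Definition dw_tensor : cidx M -> M -> 'M[R]_(n1 + n2) :=
  prod_tensor (fun p => f2 p.2) (fun p => f1 p.1) g1 g2.

Lemma dw_sym i p : cdom (mchart i) p -> (dw_tensor i p)^T = dw_tensor i p.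
Proof.
move=> dp; have [d1 d2] := dp; rewrite /dw_tensor prod_tensorE//.
by rewrite linearD !linearZ /= !trmx_mul !trmxK !metric_sym// !mulmxA.
Qed.

Lemma metric_ge0 n (N : manifold R n) (g : metric N) i p (v : 'rV[R]_n) :
  cdom (mchart i) p -> 0 <= (v *m g i p *m v^T) 0 0.
Proof.
move=> dp; have [->|v0] := eqVneq v 0; first by rewrite !mul0mx mxE.
exact/ltW/metric_pos.
Qed.

Lemma dw_pos i p : cdom (mchart i) p ->
  forall v : 'rV[R]_(n1 + n2), v != 0 -> 0 < (v *m dw_tensor i p *m v^T) 0 0.
Proof.
move=> dp v v0; have [d1 d2] := dp; rewrite /dw_tensor prod_tensorE//.
have E m (P : 'M[R]_(n1 + n2, m)) (G : 'M[R]_m) c :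
    (v *m (c *: (P *m G *m P^T)) *m v^T) = c *: (v *m P *m G *m (v *m P)^T).
  by rewrite -scalemxAr -scalemxAl trmx_mul !mulmxA.
rewrite mulmxDr mulmxDl !E !mul_rV_lin1 mxE [X in 0 < X + _]mxE [X in 0 < _ + X]mxE.
have F2 : 0 < f2 p.2 ^+ 2 by rewrite exprn_gt0// ps_gt0.
have F1 : 0 < f1 p.1 ^+ 2 by rewrite exprn_gt0// ps_gt0.
have [l0|l0] := eqVneq (lsubmx v) 0.
  have r0 : rsubmx v != 0.
    by apply: contra_neq v0 => r0; rewrite -[v]hsubmxK l0 r0 row_mx0.
  apply: ltr_wpDl; last by rewrite mulr_gt0// metric_pos.
  by rewrite mulr_ge0 ?metric_ge0// ltW.
apply: ltr_pwDl; first by rewrite mulr_gt0// metric_pos.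
by rewrite mulr_ge0 ?metric_ge0// ltW.
Qed.

Lemma dw_transition i j p : cdom (mchart i) p -> cdom (mchart j) p ->
  dw_tensor i p = pullback (N := M) idfun dw_tensor i j p.
Proof.
move=> di dj; have [di1 di2] := di; have [dj1 dj2] := dj.
set F := cmap (mchart j) \o cinv (mchart i).
set F1 := cmap (mchart j.1) \o cinv (mchart i.1).
set F2 := cmap (mchart j.2) \o cinv (mchart i.2).
pose x := cmap (mchart i) p.
have xl : lsubmx x = cmap (mchart i.1) p.1 by rewrite /x /= row_mxKl.
have xr : rsubmx x = cmap (mchart i.2) p.2 by rewrite /x /= row_mxKr.
have dF : differentiable F x.
  apply: smooth_map_differentiable (@prod_transition _ _ _ M1 M2 i j) _.
  have xj : cdom (mchart j) (cinv (mchart i) x) by rewrite /x cmapK.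
  by split; [exact: cmap_img|exact: xj].
have dF1 : differentiable F1 (lsubmx x).
  apply: smooth_map_differentiable (@manifold_transition _ _ M1 i.1 j.1) _.
  by rewrite xl; split; [exact: cmap_img|rewrite /preimage /= cmapK].
have dF2 : differentiable F2 (rsubmx x).
  apply: smooth_map_differentiable (@manifold_transition _ _ M2 i.2 j.2) _.
  by rewrite xr; split; [exact: cmap_img|rewrite /preimage /= cmapK].
have JP1 (y : 'rV[R]_(n1 + n2)) : 'J lsubmx y = P1.
  exact: jacobian_lin (@continuous_lsubmx _ _ _ _).
have dP1 (y : 'rV[R]_(n1 + n2)) : differentiable (lsubmx : _ -> 'rV[R]_n1) y.
  exact: differentiable_lsubmx.
have E1 : 'J F x *m P1 = P1 *m 'J F1 (lsubmx x).
  have A := jacobian_comp dF (dP1 (F x)); rewrite JP1 in A.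
  have B := jacobian_comp (dP1 x) dF1; rewrite JP1 in B.
  rewrite -A -B; congr jacobian; apply/funext => y.
  by rewrite /F /= row_mxKl.
have JP2 (y : 'rV[R]_(n1 + n2)) : 'J rsubmx y = P2.
  exact: jacobian_lin (@continuous_rsubmx _ _ _ _).
have dP2 (y : 'rV[R]_(n1 + n2)) : differentiable (rsubmx : _ -> 'rV[R]_n2) y.
  exact: differentiable_rsubmx.
have E2 : 'J F x *m P2 = P2 *m 'J F2 (rsubmx x).
  have A := jacobian_comp dF (dP2 (F x)); rewrite JP2 in A.
  have B := jacobian_comp (dP2 x) dF2; rewrite JP2 in B.
  rewrite -A -B; congr jacobian; apply/funext => y.
  by rewrite /F /= row_mxKr.
have T1 : g1 i.1 p.1 = 'J F1 (lsubmx x) *m g1 j.1 p.1 *m ('J F1 (lsubmx x))^T.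
  by rewrite xl; exact: metric_transition.
have T2 : g2 i.2 p.2 = 'J F2 (rsubmx x) *m g2 j.2 p.2 *m ('J F2 (rsubmx x))^T.
  by rewrite xr; exact: metric_transition.
suff : dw_tensor i p = 'J F x *m dw_tensor j p *m ('J F x)^T by [].
rewrite /dw_tensor !prod_tensorE// T1 T2.
rewrite mulmxDr mulmxDl -!scalemxAr -!scalemxAl.
congr (_ *: _ + _ *: _).
  rewrite [RHS](_ : _ = ('J F x *m P1) *m g1 j.1 p.1 *m ('J F x *m P1)^T).
    by rewrite E1 trmx_mul !mulmxA.
  by rewrite trmx_mul !mulmxA.
rewrite [RHS](_ : _ = ('J F x *m P2) *m g2 j.2 p.2 *m ('J F x *m P2)^T).
  by rewrite E2 trmx_mul !mulmxA.
by rewrite trmx_mul !mulmxA.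
Qed.

Lemma dw_smooth i a b : smooth_on (cimg (mchart i))
  (fun x => dw_tensor i (cinv (mchart i) x) a b).
Proof.
have oU : open (cimg (mchart i)) by exact: open_cimg.
pose h1 (x : 'rV[R]_(n1 + n2)) := P1 *m g1 i.1 (cinv (mchart i.1) (lsubmx x)) *m P1^T.
pose h2 (x : 'rV[R]_(n1 + n2)) := P2 *m g2 i.2 (cinv (mchart i.2) (rsubmx x)) *m P2^T.
pose u1 (x : 'rV[R]_(n1 + n2)) := f1 (cinv (mchart i.1) (lsubmx x)).
pose u2 (x : 'rV[R]_(n1 + n2)) := f2 (cinv (mchart i.2) (rsubmx x)).
have su1 : smooth_on (cimg (mchart i)) u1.
  by apply: smooth_onS (smooth_on_lsubmx (@ps_smooth _ _ _ f1 i.1)) => x [].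
have su2 : smooth_on (cimg (mchart i)) u2.
  by apply: smooth_onS (smooth_on_rsubmx (@ps_smooth _ _ _ f2 i.2)) => x [].
have sh1 : smooth_on (cimg (mchart i)) (fun x => h1 x a b).
  apply: smooth_on_conj => // c d.
  by apply: smooth_onS (smooth_on_lsubmx (metric_smooth g1 (i := i.1) c d)) => x [].
have sh2 : smooth_on (cimg (mchart i)) (fun x => h2 x a b).
  apply: smooth_on_conj => // c d.
  by apply: smooth_onS (smooth_on_rsubmx (metric_smooth g2 (i := i.2) c d)) => x [].
apply: (@smooth_on_eq _ _ _
  (fun x => u2 x * u2 x * h1 x a b + u1 x * u1 x * h2 x a b)) => //.
  move=> x; rewrite inE => Ux; rewrite /dw_tensor prod_tensorE; last exact: cinv_dom.
  by rewrite [RHS]mxE [X in _ = X + _]mxE [X in _ = _ + X]mxE !expr2.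
by apply: smooth_onD => //; do 2?[apply: smooth_onM => //].
Qed.

Definition dw_metric : metric M :=
  Metric dw_sym dw_pos dw_transition dw_smooth.

End warped_products.

Section scaling.
Context {R : realType} {n : nat} {M : manifold R n} (g : metric M).
Variables (c : R) (c0 : 0 < c).

Definition scale_tensor (i : cidx M) (p : M) : 'M[R]_n := c ^+ 2 *: g i p.

Lemma scale_sym i p : cdom (mchart i) p -> (scale_tensor i p)^T = scale_tensor i p.
Proof. by move=> dp; rewrite /scale_tensor linearZ /= metric_sym. Qed.

Lemma scale_pos i p : cdom (mchart i) p ->
  forall v : 'rV[R]_n, v != 0 -> 0 < (v *m scale_tensor i p *m v^T) 0 0.
Proof.
move=> dp v v0; rewrite /scale_tensor -scalemxAr -scalemxAl mxE mulr_gt0//.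
  by rewrite exprn_gt0.
exact: metric_pos.
Qed.

Lemma scale_transition i j p : cdom (mchart i) p -> cdom (mchart j) p ->
  scale_tensor i p = pullback idfun scale_tensor i j p.
Proof.
move=> di dj; rewrite /scale_tensor /pullback -scalemxAr -scalemxAl.
by rewrite (metric_transition g di dj).
Qed.

Lemma scale_smooth i a b : smooth_on (cimg (mchart i))
  (fun x => scale_tensor i (cinv (mchart i) x) a b).
Proof.
under [X in smooth_on _ X]eq_fun do rewrite mxE.
apply: smooth_onM; [exact: open_cimg|exact: smooth_on_cst|].
exact: metric_smooth.
Qed.

Definition scale_metric : metric M :=
  Metric scale_sym scale_pos scale_transition scale_smooth.

End scaling.

(* _{f2} M1 x M2: f1 is a constant c1, so that the metric is f2^2 g1 (+) c1^2 g2.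
   Components outside the domain of a chart carry no information. *)
Definition warped_product_form (R : realType) (n1 n2 : nat)
    (M1 : manifold R n1) (M2 : manifold R n2) (g1 : metric M1) (g2 : metric M2)
    (f1 : pos_smooth M1) (f2 : pos_smooth M2) : Prop :=
  exists (c1 : R) (c1_gt0 : 0 < c1),
    (forall x, f1 x = c1) /\
    (forall (i : cidx (prod_manifold M1 M2)) p, cdom (mchart i) p ->
      dw_metric g1 g2 f1 f2 i p =
      prod_tensor (fun q => f2 q.2) (fun=> 1) g1 (scale_metric g2 c1_gt0) i p).

(* Main.v *)
Require Import Defs.
From mathcomp Require Import all_boot all_order all_algebra.
From mathcomp Require Import all_classical all_reals all_analysis.
From mathcomp Require Import ring.

Set Implicit Arguments.
Unset Strict Implicit.
Unset Printing Implicit Defensive.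

Import Order.TTheory GRing.Theory Num.Theory numFieldNormedType.Exports.

Local Open Scope classical_set_scope.
Local Open Scope ring_scope.

(** The proof is the strong maximum principle of E. Hopf, applied on the product
    manifold to the pullback u of k = ln f_1.

    In a chart the Laplacian of any metric is a second order operator
    tr(G^-1 Hess u) - (first order terms), with G^-1 positive definite and no
    zeroth order term. At a local maximum the gradient vanishes and the Hessian
    is nonpositive, so the Laplacian is nonpositive there
    ([local_laplacian_max_le0]). Hopf's barrier argument turns this into a local
    rigidity statement: a function with nonnegative Laplacian that reaches an
    upper bound m at a point is equal to m around it
    ([strong_maximum_principle]). Indeed, if the set u = m had a boundary point
    close to x0, a Euclidean ball growing around a nearby point y where u < m
    would first touch that set at some z, and adding to u a small multiple of the
    barrier exp(-c |x - y'|^2), where y' is the midpoint of y and z, would create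
    near z an interior maximum at which the Laplacian is positive
    ([no_interior_sphere]). Therefore, on any manifold, the set where a
    subharmonic function takes its maximal value is open
    ([open_argmax_subharmonic]).

    The function u depends only on the first factor, which is compact, so it has
    a maximum although the product need not be compact. Restricted to a slice
    M_1 x {y}, the set where the maximum is reached is nonempty, closed and
    open; M_1 being connected, f_1 is constant. The equality of the metrics is
    then immediate. The argument works directly with the Laplacian of the doubly
    warped metric and never needs its expression in terms of g_1 and g_2. *)

(** * Positive definite matrices *)

Section positive_definite.
Context {R : realType}.

Definition posdefmx n (G : 'M[R]_n) :=
  forall v : 'rV[R]_n, v != 0 -> 0 < (v *m G *m v^T) 0 0.

(** Gram-Schmidt in matrix form, by induction on the size: clearing the first row
    and column with the pivot a > 0 leaves the Schur complement, which is again
    positive definite. *)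
Lemma posdefmx_orthonormal_basis n (G : 'M[R]_n) : G^T = G -> posdefmx G ->
  exists P : 'M[R]_n, P *m G *m P^T = 1%:M.
Proof.
elim: n G => [|n IH]; first by move=> G; exists 0; rewrite [LHS]flatmx0 [RHS]flatmx0.
suff: forall G : 'M[R]_(1 + n), G^T = G -> posdefmx G ->
  exists P : 'M[R]_(1 + n), P *m G *m P^T = 1%:M by [].
move=> G sG pG.
pose a := ulsubmx G 0 0; pose b := ursubmx G; pose D := drsubmx G.
have GE : G = block_mx a%:M b b^T D.
  rewrite -{1}[G]submxK (mx11_scalar (ulsubmx G)); congr block_mx.
  by rewrite /b trmx_ursub sG.
have sD : D^T = D by rewrite /D trmx_drsub sG.
have a_gt0 : 0 < a.
  have := pG (row_mx 1%:M 0).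
  rewrite GE mul_row_block !mul1mx !mul0mx !addr0 tr_row_mx mul_row_col.
  rewrite trmx1 trmx0 mulmx1 mulmx0 addr0 mxE eqxx mulr1n; apply.
  apply/eqP => /rowP /(_ (lshift n 0)); rewrite row_mxEl !mxE eqxx.
  by apply/eqP; rewrite oner_eq0.
pose L : 'M[R]_(1 + n) := block_mx 1%:M 0 (- a^-1 *: b^T) 1%:M.
pose D' := D - a^-1 *: (b^T *m b).
have LE : L *m G *m L^T = block_mx a%:M 0 0 D'.
  rewrite GE /L tr_block_mx !mulmx_block !mul1mx !mul0mx !addr0 !trmx1 !trmx0.
  rewrite !mulmx1 !mulmx0 !addr0 linearZ /= trmxK.
  rewrite -scalemxAl mul_mx_scalar scalerA mulNr mulVf ?gt_eqF//.
  rewrite scaleN1r addNr mul0mx add0r -!scalemxAl mul_scalar_mx scalerA.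
  rewrite mulrN divff ?gt_eqF// scaleN1r addNr; congr block_mx.
  by rewrite /D' addrC scaleNr.
have [|v v0|P' P'E] := IH D'.
  by rewrite /D' linearB linearZ /= trmx_mul trmxK sD.
  pose w := row_mx 0 v *m L.
  have : 0 < (w *m G *m w^T) 0 0.
    apply: pG; apply: contra_neq v0.
    rewrite /w mul_row_block !mul0mx !mulmx1 !add0r.
    by move/(congr1 rsubmx); rewrite row_mxKr linear0.
  have -> : w *m G *m w^T = row_mx 0 v *m (L *m G *m L^T) *m (row_mx 0 v)^T.
    by rewrite /w trmx_mul !mulmxA.
  rewrite LE mul_row_block tr_row_mx trmx0 mul_row_col !mul0mx !mulmx0 !add0r.
  by [].
pose Q : 'M[R]_(1 + n) := block_mx ((Num.sqrt a)^-1)%:M 0 0 P'.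
exists (Q *m L).
have -> : Q *m L *m G *m (Q *m L)^T = Q *m (L *m G *m L^T) *m Q^T.
  by rewrite trmx_mul !mulmxA.
rewrite LE /Q tr_block_mx !mulmx_block !trmx0 !(mul0mx, mulmx0, addr0, add0r).
rewrite P'E tr_scalar_mx -!scalar_mxM [RHS]scalar_mx_block.
by rewrite mulrAC -invfM -expr2 sqr_sqrtr ?mulVf ?gt_eqF// ltW.
Qed.

Lemma invmx_congruence n (G P : 'M[R]_n) :
  P *m G *m P^T = 1%:M -> invmx G = P^T *m P.
Proof.
move=> PGP; have PPG : P^T *m P *m G = 1%:M.
  by rewrite -mulmxA; apply: mulmx1C.
have [_ Gu] := mulmx1_unit PPG.
by rewrite -[LHS]mul1mx -PPG mulmxK.
Qed.

Lemma posdefmx_unit n (G : 'M[R]_n) : G^T = G -> posdefmx G -> G \in unitmx.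
Proof.
move=> sG /(posdefmx_orthonormal_basis sG)[P PGP].
have : P^T *m P *m G = 1%:M by rewrite -mulmxA; apply: mulmx1C.
by move/mulmx1_unit => [].
Qed.

Lemma posdefmx_inv n (G : 'M[R]_n) : G^T = G -> posdefmx G ->
  posdefmx (invmx G).
Proof.
move=> sG pG v v0; have Gu := posdefmx_unit sG pG.
have := pG (v *m invmx G); rewrite trmx_mul trmx_inv sG !mulmxA mulmxKV//.
apply; apply: contra_neq v0 => vG0.
by rewrite -[v](mulmxKV Gu) vG0 mul0mx.
Qed.

(** In a basis orthonormal for G, the trace is the sum of the values of the form
    H on the basis vectors. *)
Lemma mxtrace_invmx_le0 n (G H : 'M[R]_n) : G^T = G -> posdefmx G ->
  (forall v : 'rV[R]_n, (v *m H *m v^T) 0 0 <= 0) -> \tr (invmx G *m H) <= 0.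
Proof.
move=> sG /(posdefmx_orthonormal_basis sG)[P PGP] H0.
rewrite (invmx_congruence PGP) -mulmxA mxtrace_mulC.
apply: sumr_le0 => i _.
suff -> : (P *m H *m P^T) i i = (row i P *m H *m (row i P)^T) 0 0 by [].
rewrite -row_mul !mxE; apply: eq_bigr => j _; by rewrite !mxE.
Qed.

End positive_definite.

(** * Continuity of matrix inversion *)

Section continuity.
Context {R : realType} {T : topologicalType}.

Lemma continuous_at_sum (I : Type) (r : seq I) (P : pred I) (f : I -> T -> R) z :
  (forall i, {for z, continuous (f i)}) ->
  {for z, continuous (fun x => \sum_(i <- r | P i) f i x)}.
Proof. by move=> fc; apply: cvg_big => [|i _]; [exact: add_continuous|exact: fc]. Qed.

Lemma continuous_at_prod (I : Type) (r : seq I) (P : pred I) (f : I -> T -> R) z :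
  (forall i, {for z, continuous (f i)}) ->
  {for z, continuous (fun x => \prod_(i <- r | P i) f i x)}.
Proof. by move=> fc; apply: cvg_big => [|i _]; [exact: mul_continuous|exact: fc]. Qed.

Lemma continuous_at_det n (G : T -> 'M[R]_n) z :
  (forall a b, {for z, continuous (fun x => G x a b)}) ->
  {for z, continuous (fun x => \det (G x))}.
Proof.
move=> Gc; apply: continuous_at_sum => s; apply: cvgM; first exact: cvg_cst.
exact: continuous_at_prod.
Qed.

(** Cramer's rule, valid around z because the determinant stays nonzero there. *)
Lemma continuous_at_invmx n (G : T -> 'M[R]_n) z a b :
  (forall a b, {for z, continuous (fun x => G x a b)}) ->
  G z \in unitmx -> {for z, continuous (fun x => invmx (G x) a b)}.
Proof.
move=> Gc Gu; have dz : \det (G z) != 0 by rewrite -unitfE.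
have dc := continuous_at_det Gc.
have nd : \forall x \near z, \det (G x) != 0.
  have /dc : nbhs (\det (G z)) [set d | d != 0] by
    apply: open_nbhs_nbhs; split => //; exact: open_neq.
  exact.
have adjc : {for z, continuous (fun x => \adj (G x) a b)}.
  have -> : (fun x => \adj (G x) a b) =
      (fun x => (-1) ^+ (b + a) * \det (row' b (col' a (G x)))).
    by apply/funext => x; rewrite mxE.
  apply: cvgM; first exact: cvg_cst.
  apply: (@continuous_at_det _ (fun x => row' b (col' a (G x)))) => c d.
  have -> : (fun x => row' b (col' a (G x)) c d) = fun x => G x (lift b c) (lift a d).
    by apply/funext => x; rewrite !mxE.
  exact: Gc.
have H : {for z, continuous (fun x => (\det (G x))^-1 * \adj (G x) a b)}.
  by apply: cvgM => //; exact: cvgV.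
have E x : \det (G x) != 0 ->
    (\det (G x))^-1 * \adj (G x) a b = invmx (G x) a b.
  by rewrite -unitfE => Gx; rewrite /invmx unitmxE Gx [RHS]mxE.
rewrite /prop_for /continuous_at -E//. apply: (cvg_trans _ H).

by apply: near_eq_cvg; near=> x; rewrite /= E//; near: x.
Unshelve. all: by end_near. Qed.

End continuity.

(** * Second order calculus *)

Section calculus.
Context {R : realType}.

Lemma is_derive_line (V : normedModType R) (f : V -> R) x v t d :
  is_derive (x + t *: v) v f d -> is_derive t 1 (fun s => f (x + s *: v)) d.
Proof.
move=> [fd fE].
have E : (fun h => h^-1 *: (((fun s => f (x + s *: v)) \o shift t) (h *: 1) -
      f (x + t *: v))) =
    (fun h => h^-1 *: ((f \o shift (x + t *: v)) (h *: v) - f (x + t *: v))).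
  apply/funext => h /=; congr (_ *: (f _ - _)).
  by rewrite [h *: 1]mulr1 scalerDl addrCA.
by apply: DeriveDef; [rewrite /derivable E|rewrite /derive E].
Qed.

(** If g''(0) = c were positive, g' = w, which vanishes at the maximum 0, would be
    positive just after 0, and by the mean value theorem g would exceed g 0. *)
Lemma max_second_derivative (g w : R -> R) (c : R) :
  (\forall t \near (0 : R), is_derive (t : R) 1 g (w t)) -> is_derive (0 : R) 1 w c ->
  (\forall t \near (0 : R), g t <= g 0) -> w 0 = 0 /\ c <= 0.
Proof.
move=> gw wc gmax.
have w0 : w 0 = 0.
  have [e /= e0 He] : \forall t \near (0 : R),
      is_derive (t : R) 1 g (w t) /\ g t <= g 0.
    by apply: filterI.
  have He' t : t \in `](-e), e[%R -> is_derive (t : R) 1 g (w t) /\ g t <= g 0.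
    by rewrite in_itv /= => te; apply: He; rewrite /= sub0r normrN ltr_norml.
  have i0 : 0 \in `](-e), e[%R by rewrite in_itv /= oppr_lt0 e0.
  have [_ d1] : is_derive (0 : R) 1 g 0.
    apply: (@derive1_at_max _ _ (-e) e) => //.
    - by rewrite -subr_ge0 opprK addr_ge0// ltW.
    - by move=> t /He'[].
    - by move=> t /He'[].
  by have [[_ <-] _] := He' 0 i0.
split=> //; rewrite leNgt; apply/negP => c0.
have [wd wE] := wc.
have : (fun h => h^-1 *: ((w \o shift 0) (h *: 1) - w 0)) @ 0^' --> c.
  by rewrite -wE; exact: wd.
move=> /cvgr_gt /(_ _ c0) wpos.
have {}wpos : \forall t \near (0 : R), t != 0 -> 0 < t^-1 * w t.
  have [e /= e0 He] := wpos; exists e => //= t te t0.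
  by have := He t te t0; rewrite /= w0 subr0 addr0 [t *: 1]mulr1.
have [e /= e0 He] : \forall t \near (0 : R), (t != 0 -> 0 < t^-1 * w t) /\
    is_derive (t : R) 1 g (w t) /\ g t <= g 0.
  by apply: filterI => //; exact: filterI.
have He' t : 0 < t < e ->
    (t != 0 -> 0 < t^-1 * w t) /\ is_derive (t : R) 1 g (w t) /\ g t <= g 0.
  by move=> /andP[t0 te]; apply: He; rewrite /= sub0r normrN gtr0_norm.
pose b := e / 2.
have b0 : 0 < b by rewrite divr_gt0.
have be : b < e by rewrite /b gtr_pMr// invf_lt1// ltr1n.
have [||t] := @MVT R g w 0 b b0.
- move=> t; rewrite in_itv /= => /andP[t0 tb].
  by have [] := He' t; rewrite ?t0 ?(lt_trans tb)// => _ [].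
- apply: derivable_within_continuous => t; rewrite in_itv /= => /andP[t0 tb].
  have := He t; rewrite /= sub0r normrN ger0_norm// => /(_ (le_lt_trans tb be)).
  by move=> [_ [[]]].
rewrite in_itv /= => /andP[t0 tb] E.
have [|_ [_]] := He' b; first by rewrite b0.
have [|wt _] := He' t; first by rewrite t0 (lt_trans tb be).
rewrite -subr_le0 E subr0 pmulr_lle0// leNgt => /negP; apply.
by have := wt (lt0r_neq0 t0); rewrite pmulr_rgt0// invr_gt0.
Qed.

(** The regularity needed to expand the Laplacian of a sum or of a composition.
    Unlike smoothness of all orders, it passes to ln o f and to the barrier by a
    single application of the chain rule. *)
Definition twice_differentiable_on n (U : set 'rV[R]_n) (f : 'rV[R]_n -> R) :=
  (forall x, U x -> differentiable f x) /\
  (forall i x, U x -> differentiable (partial i f) x).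

Definition hessian_mx n (f : 'rV[R]_n -> R) (x : 'rV[R]_n) : 'M[R]_n :=
  \matrix_(a, b) partial a (partial b f) x.

Definition gradient_mx n (f : 'rV[R]_n -> R) (x : 'rV[R]_n) : 'rV[R]_n :=
  \row_a partial a f x.

Lemma smooth_on_twice_differentiable n (U : set 'rV[R]_n) f :
  smooth_on U f -> twice_differentiable_on U f.
Proof. by move=> sf; split=> [|i]; [exact: (sf [::])|exact: (sf [:: i])]. Qed.

Lemma derive_gradient n (f : 'rV[R]_n -> R) x v : differentiable f x ->
  'D_v f x = (gradient_mx f x *m v^T) 0 0.
Proof.
move=> fd; rewrite deriveE// {1}[v]row_sum_delta linear_sum mxE.
apply: eq_bigr => i _; rewrite linearZ /= !mxE mulrC -deriveE//.
Qed.

(** The one-dimensional test on every line through the maximum. *)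
Lemma max_gradient_hessian n (U : set 'rV[R]_n) f x : open U -> U x ->
  twice_differentiable_on U f -> (\forall y \near x, f y <= f x) ->
  gradient_mx f x = 0 /\
  forall v : 'rV[R]_n, (v *m hessian_mx f x *m v^T) 0 0 <= 0.
Proof.
move=> oU Ux [df ddf] fmax.
have nU : nbhs x U by exact: open_nbhs_nbhs.
suff H (v : 'rV[R]_n) : 'D_v f x = 0 /\ (v *m hessian_mx f x *m v^T) 0 0 <= 0.
  split=> [|v]; last exact: (H v).2.
  by apply/rowP => i; rewrite !mxE; exact: (H _).1.
have line (A : set 'rV[R]_n) : nbhs x A -> \forall t \near 0, A (x + t *: v).
  move=> nA; have : (fun t : R => x + t *: v) @ 0 --> x + 0 *: v.
    by apply: cvgD; [exact: cvg_cst|apply: cvgZl; exact: cvg_id].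
  by rewrite scale0r addr0; apply.
pose w t := 'D_v f (x + t *: v).
have [|||w0] := @max_second_derivative (fun t => f (x + t *: v)) w
  ((v *m hessian_mx f x *m v^T) 0 0).
- apply: filterS (line _ nU) => t Ut; apply: is_derive_line.
  by apply: DeriveDef => //; exact/diff_derivable/df.
- have E : \forall t \near 0,
     (gradient_mx f (x + t *: v) *m v^T) 0 0 = w t.
    by apply: filterS (line _ nU) => t Ut; rewrite /w derive_gradient//; exact: df.
  apply: near_eq_is_derive E _.
  apply: (@is_derive_line _ (fun y => (gradient_mx f y *m v^T) 0 0)).
  rewrite scale0r addr0.
  have -> : (fun y => (gradient_mx f y *m v^T) 0 0) =
      \sum_(b < n) (v 0 b *: partial b f).
    apply/funext => y; rewrite mxE fct_sumE; apply: eq_bigr => b _.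
    by rewrite !mxE mulrC.
  have -> : (v *m hessian_mx f x *m v^T) 0 0 =
      \sum_(b < n) v 0 b *: 'D_v (partial b f) x.
    rewrite mxE; apply: eq_bigr => b _.
    rewrite derive_gradient; last exact: ddf.
    rewrite [v^T b 0]mxE [LHS]mulrC; congr (_ * _); rewrite !mxE.
    by apply: eq_bigr => a _; rewrite !mxE mulrC.
  apply: is_derive_sum => b.
  by apply: is_deriveZ; apply: DeriveDef => //; apply/diff_derivable/ddf.
- by apply: filterS (line _ fmax) => t; rewrite scale0r addr0.
- by rewrite /w scale0r addr0 in w0 *.
Qed.

Lemma is_derive_comp (V : normedModType R) (h : R -> R) (f : V -> R) x v d :
  is_derive (f x) 1 h d -> differentiable f x ->
  is_derive x v (h \o f) (d * 'D_v f x).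
Proof.
move=> [hd <-] fd; have hD : differentiable h (f x) by exact/derivable1_diffP.
apply: DeriveDef.
  by apply: diff_derivable; exact: differentiable_comp.
rewrite deriveE; last exact: differentiable_comp.
rewrite diff_comp//= !deriveE// -[X in 'd h _ X = _]mulr1.
by rewrite [LHS]linearZ mulrC.
Qed.

Lemma is_derive_scaled_exp (k c t : R) :
  is_derive t (1 : R) (fun t => k * expR (c * t)) (c * k * expR (c * t)).
Proof.
have d1 : is_derive t (1 : R) (fun s : R => c * s) c.
  by apply: is_derive_eq; rewrite /GRing.scale /= mulr1.
have d2 : is_derive t (1 : R) (expR \o (fun s : R => c * s)) (expR (c * t) * c).
  exact: is_derive1_comp.
apply: (@is_derive_eq _ _ _ (k *: (expR \o (fun s : R => c * s)))).
by rewrite /GRing.scale /=; ring.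
Qed.

Lemma near_open_eq n (U : set 'rV[R]_n) (f g : 'rV[R]_n -> R) x :
  open U -> U x -> (forall y, U y -> f y = g y) -> \forall y \near x, f y = g y.
Proof. by move=> oU Ux fg; apply: filterS fg _; exact: open_nbhs_nbhs. Qed.

Section composition.
Context {n : nat} (U : set 'rV[R]_n) (f : 'rV[R]_n -> R) (h h1 h2 : R -> R).
Hypotheses (oU : open U) (f2 : twice_differentiable_on U f).
Hypothesis dh : forall x, U x -> is_derive (f x) (1 : R) h (h1 (f x)).
Hypothesis dh1 : forall x, U x -> is_derive (f x) (1 : R) h1 (h2 (f x)).

Lemma partial_comp i x : U x -> partial i (h \o f) x = h1 (f x) * partial i f x.
Proof.
by move=> Ux; have [_] := is_derive_comp (delta_mx 0 i) (dh Ux) (f2.1 _ Ux).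
Qed.

Let differentiable_comp1 (k dk : R -> R) x : U x ->
  is_derive (f x) (1 : R) k (dk (f x)) -> differentiable (k \o f) x.
Proof.
move=> Ux [kd _]; apply: differentiable_comp; first exact: f2.1.
exact/derivable1_diffP.
Qed.

Lemma twice_differentiable_comp : twice_differentiable_on U (h \o f).
Proof.
split=> [x Ux|i x Ux]; first exact: differentiable_comp1 (dh Ux).
apply: (@differentiable_near _ _ _ (fun y => (h1 \o f) y * partial i f y)).
  apply: near_open_eq oU Ux _ => y Uy; rewrite partial_comp//.
apply: differentiableM; first exact: differentiable_comp1 (dh1 Ux).
exact: f2.2.
Qed.

Lemma hessian_comp x : U x -> hessian_mx (h \o f) x =
  h1 (f x) *: hessian_mx f x +
  h2 (f x) *: ((gradient_mx f x)^T *m gradient_mx f x).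
Proof.
move=> Ux; apply/matrixP => a b; rewrite !mxE big_ord1 !mxE.
rewrite [LHS](@near_eq_derive _ _ _ _ (fun y => (h1 \o f) y * partial b f y)).
  rewrite deriveM; last 2 first.
  - by have [] := is_derive_comp (delta_mx 0 a) (dh1 Ux) (f2.1 _ Ux).
  - exact/diff_derivable/f2.2.
  have [_ ->] := is_derive_comp (delta_mx 0 a) (dh1 Ux) (f2.1 _ Ux).
  congr (_ + _); rewrite [LHS]mulrC -mulrA; congr (_ * _).
apply: near_open_eq oU Ux _ => y Uy; rewrite partial_comp//.
Qed.

Lemma gradient_comp x : U x ->
  gradient_mx (h \o f) x = h1 (f x) *: gradient_mx f x.
Proof. by move=> Ux; apply/rowP => i; rewrite !mxE partial_comp. Qed.

End composition.

Section addition.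
Context {n : nat} (U : set 'rV[R]_n) (f g : 'rV[R]_n -> R).
Hypotheses (oU : open U).
Hypotheses (f2 : twice_differentiable_on U f) (g2 : twice_differentiable_on U g).

Lemma partialD i x : U x -> partial i (f \+ g) x = partial i f x + partial i g x.
Proof.
move=> Ux; rewrite /partial deriveD//; apply: diff_derivable.
  exact: f2.1.
exact: g2.1.
Qed.

Lemma twice_differentiableD : twice_differentiable_on U (f \+ g).
Proof.
split=> [x Ux|i x Ux].
  by apply: differentiableD; [exact: f2.1|exact: g2.1].
apply: (@differentiable_near _ _ _ (partial i f \+ partial i g)).
  by apply: near_open_eq oU Ux _ => y Uy; rewrite partialD.
by apply: differentiableD; [exact: f2.2|exact: g2.2].
Qed.

Lemma hessianD x : U x -> hessian_mx (f \+ g) x = hessian_mx f x + hessian_mx g x.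
Proof.
move=> Ux; apply/matrixP => a b; rewrite !mxE.
rewrite [LHS](@near_eq_derive _ _ _ _ (partial b f \+ partial b g)).
  by rewrite deriveD//; apply: diff_derivable; [exact: f2.2|exact: g2.2].
by apply: near_open_eq oU Ux _ => y Uy; rewrite partialD.
Qed.

Lemma gradientD x : U x -> gradient_mx (f \+ g) x = gradient_mx f x + gradient_mx g x.
Proof. by move=> Ux; apply/rowP => i; rewrite !mxE partialD. Qed.

End addition.

(** The Hessian of a metric depends linearly on the Euclidean Hessian and
    gradient; this reduces the sum and chain rules for the Laplacian to those of
    these two. *)
Lemma local_hessianE n (G : 'rV[R]_n -> 'M[R]_n) u x :
  local_hessian G u x = hessian_mx u x -
    \sum_c gradient_mx u x 0 c *: \matrix_(a, b) christoffel G c a b x.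
Proof.
apply/matrixP => a b; rewrite !mxE summxE; congr (_ - _).
by apply: eq_bigr => c _; rewrite !mxE mulrC.
Qed.

Lemma local_laplacianD n (G : 'rV[R]_n -> 'M[R]_n) (U : set 'rV[R]_n) f g x :
  open U -> U x -> twice_differentiable_on U f -> twice_differentiable_on U g ->
  local_laplacian G (f \+ g) x = local_laplacian G f x + local_laplacian G g x.
Proof.
move=> oU Ux f2 g2; rewrite /local_laplacian -linearD /= -mulmxDr.
congr (\tr (_ *m _)); rewrite !local_hessianE (hessianD oU f2 g2 Ux).
rewrite (gradientD f2 g2 Ux) addrACA -opprD -big_split; congr (_ - _).
by apply: eq_bigr => c _; rewrite mxE scalerDl.
Qed.

(** The second order term of the chain rule is the rank one form
    (grad f)^T (grad f), whose trace against G^-1 is the squared norm of df for the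
    dual metric. *)
Lemma local_laplacian_comp n (G : 'rV[R]_n -> 'M[R]_n) (U : set 'rV[R]_n) f
    (h h1 h2 : R -> R) x :
  open U -> U x -> twice_differentiable_on U f ->
  (forall x, U x -> is_derive (f x) (1 : R) h (h1 (f x))) ->
  (forall x, U x -> is_derive (f x) (1 : R) h1 (h2 (f x))) ->
  local_laplacian G (h \o f) x = h1 (f x) * local_laplacian G f x +
    h2 (f x) * (gradient_mx f x *m invmx (G x) *m (gradient_mx f x)^T) 0 0.
Proof.
move=> oU Ux f2 dh dh1; rewrite /local_laplacian.
have -> : local_hessian G (h \o f) x = h1 (f x) *: local_hessian G f x +
    h2 (f x) *: ((gradient_mx f x)^T *m gradient_mx f x).
  rewrite !local_hessianE (hessian_comp oU f2 dh dh1 Ux) addrAC; congr (_ + _).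
  rewrite scalerBr scaler_sumr; congr (_ - _); apply: eq_bigr => c _.
  by rewrite (gradient_comp f2 dh Ux) mxE scalerA.
rewrite mulmxDr linearD /= -!scalemxAr !linearZ /=; congr (_ + _ * _).
by rewrite mulmxA mxtrace_mulC mulmxA trace_mx11.
Qed.

(** The Christoffel symbols are multiplied by first derivatives, which vanish at a
    maximum: the sign comes from the Euclidean Hessian alone. *)
Lemma local_laplacian_max_le0 n (G : 'rV[R]_n -> 'M[R]_n) (U : set 'rV[R]_n) u x :
  open U -> U x -> twice_differentiable_on U u ->
  (G x)^T = G x -> posdefmx (G x) ->
  (\forall y \near x, u y <= u x) -> local_laplacian G u x <= 0.
Proof.
move=> oU Ux u2 sG pG umax.
have [gu0 Hu] := max_gradient_hessian oU Ux u2 umax.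
rewrite /local_laplacian local_hessianE gu0 big1 ?subr0.
  exact: mxtrace_invmx_le0.
by move=> c _; rewrite mxE scale0r.
Qed.

End calculus.

(** * The squared Euclidean distance *)

Section squared_distance.
Context {R : realType} {n : nat}.
Implicit Types x y z : 'rV[R]_n.

Definition sqdist y x : R := \sum_i (x 0 i - y 0 i) ^+ 2.

Lemma sqdist_ge0 y x : 0 <= sqdist y x.
Proof. by apply: sumr_ge0 => i _; exact: sqr_ge0. Qed.

Lemma sqdist_gt0 y x : x != y -> 0 < sqdist y x.
Proof.
move=> xy; rewrite lt0r sqdist_ge0 andbT; apply: contra_neq xy => /eqP.
rewrite psumr_eq0 => [/allP q0|i _]; last exact: sqr_ge0.
apply/rowP => i; apply/eqP; rewrite -subr_eq0 -sqrf_eq0.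
by apply: q0; rewrite mem_index_enum.
Qed.

(** The norm on row vectors is the maximum norm, whose balls are cubes; the
    comparison with the Euclidean distance is what places Euclidean neighbours
    inside a given cube. *)
Lemma norm_le_sqrt_sqdist y x : `|x - y| <= Num.sqrt (sqdist y x).
Proof.
rewrite /Num.Def.normr/= mx_normrE (bigmax_le _ (sqrtr_ge0 _))//= => -[k i] _ /=.
rewrite -sqrtr_sqr ler_wsqrtr// !mxE ord1 /sqdist (bigD1 i)//= lerDl.
by apply: sumr_ge0 => j _; exact: sqr_ge0.
Qed.

(** Moving the centre from y to the midpoint makes the contact strict: the smaller
    ball touches the boundary of the larger one only at z. *)
Lemma sqdist_midpoint y z x :
  sqdist y z <= sqdist y x -> x != z ->
  sqdist (2^-1 *: (y + z)) z < sqdist (2^-1 *: (y + z)) x.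
Proof.
move=> yzx /sqdist_gt0 xz.
have E : 2 * (sqdist (2^-1 *: (y + z)) x - sqdist (2^-1 *: (y + z)) z) =
    sqdist y x - sqdist y z + sqdist z x.
  rewrite /sqdist -!sumrB -big_split /= mulr_sumr; apply: eq_bigr => i _.
  by rewrite !mxE; field.
by rewrite -subr_gt0 -(pmulr_rgt0 _ (ltr0n R 2)) E ltr_wpDl// subr_ge0.
Qed.

Lemma is_derive_coord i x v : is_derive x v (fun x => x 0 i) (v 0 i).
Proof.
have dc : differentiable (fun x => x 0 i) x by exact: differentiable_coord.
apply: DeriveDef; first exact: diff_derivable.
by rewrite -[in RHS](derive_id x v) derive_mx ?mxE//; exact: derivable_id.
Qed.

Lemma is_derive_sqdist y x v :
  is_derive x v (sqdist y) (\sum_i 2 * (x 0 i - y 0 i) * v 0 i).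
Proof.
have -> : sqdist y = \sum_i ((fun x => x 0 i) - cst (y 0 i)) ^+ 2.
  by apply/funext => u; rewrite fct_sumE.
apply: is_derive_sum => i; have di := is_derive_coord i x v.
by apply: is_derive_eq; rewrite /= subr0.
Qed.

Lemma partial_sqdist y i : partial i (sqdist y) = fun x => 2 * (x 0 i - y 0 i).
Proof.
apply/funext => x; have [_ dE] := is_derive_sqdist y x (delta_mx 0 i).
rewrite /partial dE (bigD1 i)//= big1 ?addr0 => [|j ji]; rewrite mxE ?eqxx ?mulr1//.
by rewrite (negbTE ji) andbF mulr0.
Qed.

Lemma partial2_sqdist y i j x :
  partial j (partial i (sqdist y)) x = 2 * (i == j)%:R.
Proof.
rewrite partial_sqdist /partial.
have di := is_derive_coord i x (delta_mx 0 j).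
have -> : (fun x => 2 * (x 0 i - y 0 i)) = 2 *: ((fun x => x 0 i) - cst (y 0 i)).
  by [].
by rewrite derive_val subr0 mxE eqxx.
Qed.

Lemma gradient_sqdist y x : gradient_mx (sqdist y) x = 2 *: (x - y).
Proof. by apply/rowP => i; rewrite !mxE partial_sqdist. Qed.

Lemma twice_differentiable_sqdist y U : twice_differentiable_on U (sqdist y).
Proof.
have dc i x : differentiable (fun x => x 0 i - y 0 i) x.
  by apply: differentiableB => //; exact: differentiable_coord.
split=> [x _|i x _].
  have -> : sqdist y = \sum_i (fun x => x 0 i - y 0 i) ^+ 2.
    by apply/funext => u; rewrite fct_sumE.
  by apply: differentiable_sum => i; exact: differentiableX.
rewrite partial_sqdist; apply: (@differentiableZ _ _ _ (fun x => x 0 i - y 0 i)).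
exact: dc.
Qed.

Lemma continuous_sqdist y : continuous (sqdist y).
Proof.
move=> x; apply: differentiable_continuous.
exact: (twice_differentiable_sqdist y setT).1.
Qed.

End squared_distance.

(** * Continuity of the Laplacian *)

Section laplacian_continuity.
Context {R : realType} {n : nat} (G : 'rV[R]_n -> 'M[R]_n) (U : set 'rV[R]_n).
Hypothesis G_smooth : forall a b, smooth_on U (fun x => G x a b).

Let G_continuous z a b : U z -> {for z, continuous (fun x => G x a b)}.
Proof. by move=> Uz; exact: (differentiable_continuous (@G_smooth a b [::] z Uz)). Qed.

Let partial_G_continuous z a b c :
  U z -> {for z, continuous (partial c (fun x => G x a b))}.
Proof.
by move=> Uz; exact: (differentiable_continuous (@G_smooth a b [:: c] z Uz)).
Qed.

Lemma continuous_christoffel z c a b : U z -> G z \in unitmx ->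
  {for z, continuous (christoffel G c a b)}.
Proof.
move=> Uz Gu.
apply: (@continuousM _ _ (fun=> 2^-1)); first exact: cst_continuous.
apply: continuous_at_sum => d.
apply: (@continuousM _ _ (fun x => invmx (G x) c d)).
  by apply: continuous_at_invmx => // *; exact: G_continuous.
apply: continuousB; last exact: partial_G_continuous.
by apply: continuousD; exact: partial_G_continuous.
Qed.

Lemma continuous_local_laplacian u z : U z -> G z \in unitmx ->
  (forall a, {for z, continuous (partial a u)}) ->
  (forall a b, {for z, continuous (partial a (partial b u))}) ->
  {for z, continuous (local_laplacian G u)}.
Proof.
move=> Uz Gu u1 u2.
have -> : local_laplacian G u = fun x => \sum_i \sum_j invmx (G x) i j *
    (partial j (partial i u) x - \sum_c christoffel G c j i x * partial c u x).
  apply/funext => x; apply: eq_bigr => i _; rewrite mxE.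
  by apply: eq_bigr => j _; rewrite [local_hessian _ _ _ _ _]mxE.
apply: continuous_at_sum => i; apply: continuous_at_sum => j.
apply: (@continuousM _ _ (fun x => invmx (G x) i j)).
  by apply: continuous_at_invmx => // *; exact: G_continuous.
apply: continuousB; first exact: u2.
apply: continuous_at_sum => c; apply: continuousM; last exact: u1.
exact: continuous_christoffel.
Qed.

End laplacian_continuity.

(** * The strong maximum principle *)

Section maximum_principle.
Context {R : realType} {n : nat} (G : 'rV[R]_n -> 'M[R]_n) (U : set 'rV[R]_n).
Hypothesis oU : open U.
Hypothesis G_smooth : forall a b, smooth_on U (fun x => G x a b).
Hypothesis G_sym : forall x, U x -> (G x)^T = G x.
Hypothesis G_pos : forall x, U x -> posdefmx (G x).

Let K (z : 'rV[R]_n) (r : R) := closed_ball_ Num.Def.normr z r.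

Let compact_K z r : compact (K z r).
Proof.
apply: bounded_closed_compact; last exact: closed_closed_ball_.
exists (`|z| + r); split; first exact: num_real.
move=> M zrM x zx; apply: le_trans (ltW zrM).
rewrite -[x](subKr z) (le_trans (ler_normB _ _))// lerD2l.
exact: zx.
Qed.

Let continuous_on_compact (f : 'rV[R]_n -> R) (A : set 'rV[R]_n) :
  A `<=` U -> (forall x, U x -> differentiable f x) -> {within A, continuous f}.
Proof.
move=> AU fd; apply: continuous_in_subspaceT => x; rewrite inE => /AU Ux.
exact/differentiable_continuous/fd.
Qed.

Let nbhs_K z (A : set 'rV[R]_n) : nbhs z A -> exists2 r, 0 < r & K z r `<=` A.
Proof.
move=> /nbhs_closedballP[r rA]; exists r%:num => //.
by rewrite /K -closed_ballE.
Qed.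

(** With s = |x - y|^2, the Laplacian of exp(-c s) is
    c exp(-c s) (c |ds|^2 - Laplacian of s). As ds is nonzero at z, a large c makes
    the last factor positive at z, hence around it. The neighbourhood does not
    depend on the amplitude e, which is chosen only once it is known. *)
Lemma barrier_laplacian z y : U z -> z != y ->
  exists2 c : R, 0 < c &
  \forall x \near z, forall e : R, 0 < e ->
    0 < local_laplacian G ((fun t => e * expR (- c * t)) \o sqdist y) x.
Proof.
move=> Uz zy.
pose L := local_laplacian G (sqdist y).
pose Q x := (gradient_mx (sqdist y) x *m invmx (G x) *m
  (gradient_mx (sqdist y) x)^T) 0 0.
have Qz : 0 < Q z.
  apply: posdefmx_inv; [exact: G_sym|exact: G_pos|].
  by rewrite gradient_sqdist scaler_eq0 pnatr_eq0 /= subr_eq0.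
(* so that c * Q z = |L z| + 1 > L z *)
pose c := (`|L z| + 1) / Q z.
have c0 : 0 < c by rewrite divr_gt0// ltr_wpDl.
exists c => //.
have Gu : G z \in unitmx by apply: posdefmx_unit; [exact: G_sym|exact: G_pos].
have dq := twice_differentiable_sqdist y (setT : set 'rV[R]_n).
have pc a : {for z, continuous (partial a (sqdist y))}.
  by apply: differentiable_continuous; exact: dq.2.
have Lc : {for z, continuous L}.
  apply: continuous_local_laplacian => // a b.
  have -> : partial a (partial b (sqdist y)) = cst (2 * (b == a)%:R).
    by apply/funext => x; rewrite partial2_sqdist.
  exact: cst_continuous.
have gc a : {for z, continuous (fun x => gradient_mx (sqdist y) x 0 a)}.
  have -> : (fun x => gradient_mx (sqdist y) x 0 a) = partial a (sqdist y).
    by apply/funext => x; rewrite mxE.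
  exact: pc.
have Qc : {for z, continuous Q}.
  have -> : Q = fun x => \sum_j (\sum_i gradient_mx (sqdist y) x 0 i *
      invmx (G x) i j) * gradient_mx (sqdist y) x 0 j.
    apply/funext => x; rewrite /Q mxE; apply: eq_bigr => j _.
    by rewrite [X in X * _]mxE [X in _ * X]mxE.
  apply: continuous_at_sum => j; apply: continuousM; last exact: gc.
  apply: continuous_at_sum => i; apply: continuousM; first exact: gc.
  apply: continuous_at_invmx => // a b.
  exact: (differentiable_continuous (@G_smooth a b [::] z Uz)).
have Dc : {for z, continuous (fun x => c * Q x - L x)}.
  by apply: continuousB => //; apply: continuousM => //; exact: cst_continuous.
have Dz : 0 < c * Q z - L z.
  rewrite /c divfK ?gt_eqF// subr_gt0.
  by rewrite (le_lt_trans (ler_norm _))// ltrDl.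
have nD : \forall x \near z, 0 < c * Q x - L x.
  exact: ((cvgr_gt _ Dc) _ Dz).
near=> x => e e0.
have dh t := is_derive_scaled_exp e (- c) t.
have dh1 t := is_derive_scaled_exp (- c * e) (- c) t.
rewrite [ltRHS](@local_laplacian_comp _ _ G setT (sqdist y) _
  (fun t => - c * e * expR (- c * t))
  (fun t => - c * (- c * e) * expR (- c * t)) x openT I dq
  (fun x _ => dh (sqdist y x)) (fun x _ => dh1 (sqdist y x))).
rewrite [ltRHS](_ : _ = c * e * expR (- c * sqdist y x) * (c * Q x - L x)).
  apply: mulr_gt0; last by near: x.
  by rewrite mulr_gt0 ?expR_gt0// mulr_gt0.
by rewrite /L /Q; ring.
Unshelve. all: by end_near. Qed.

Section subharmonic.
Variables (u : 'rV[R]_n -> R) (m : R).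
Hypothesis u2 : twice_differentiable_on U u.
Hypothesis u_subharmonic : forall x, U x -> 0 <= local_laplacian G u x.
Hypothesis u_le : forall x, U x -> u x <= m.

(** Let the barrier be centred at the midpoint y' of y and z. On the boundary of a
    small cube around z, the part C where the barrier is at least its value at z
    avoids u = m, so that u <= m - d on it for some d > 0. Adding the barrier with
    amplitude d then keeps the boundary values below the value at z: on C because
    the barrier is at most d, elsewhere because it is smaller than at z. The
    maximum over the cube is thus interior, where the positive Laplacian
    excludes it. *)
Lemma no_interior_sphere y z : U z -> z != y -> u z = m ->
  (\forall x \near z, u x = m -> sqdist y z <= sqdist y x) -> False.
Proof.
move=> Uz zy uz near_far.
pose y' := 2^-1 *: (y + z).
have zy' : z != y'.
  apply: contra_neq zy => zy'; apply: (@scalerI _ _ 2^-1).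
    by rewrite invr_eq0 pnatr_eq0.
  apply: (@addIr _ (2^-1 *: z)).
  by rewrite -[RHS]scalerDr -/y' -zy' -scalerDl (_ : 2^-1 + 2^-1 = 1) ?scale1r//; field.
have [c c0 Lpos] := barrier_laplacian Uz zy'.
have nU : nbhs z U by exact: open_nbhs_nbhs.
have [r r0 rE] := nbhs_K (filterI (filterI nU Lpos) near_far).
have KU x : K z r x -> U x by move=> /rE[[]].
have KL x : K z r x -> forall e, 0 < e ->
    0 < local_laplacian G ((fun t => e * expR (- c * t)) \o sqdist y') x.
  by move=> /rE[[]].
pose C := K z r `&` [set x | sqdist y' x <= sqdist y' z] `&` [set x | r <= `|z - x|].
have uC x : C x -> u x < m.
  move=> [[Kx xy'] xr]; rewrite lt_neqAle u_le ?andbT; last exact: KU.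
  apply/eqP => ux; have [_ /(_ ux) yzx] := rE _ Kx.
  have xz : x != z.
    by apply: contraTneq xr => ->; rewrite /= subrr normr0 -ltNge.
  by have := sqdist_midpoint yzx xz; rewrite ltNge => /negP; apply.
have cC : compact C.
  apply: (subclosed_compact _ (@compact_K z r)); last by move=> x [[]].
  apply: closedI; first apply: closedI.
  - exact: closed_closed_ball_.
  - apply: (@preimage_closed _ _ (sqdist y') _ _ (@closed_le _ _)) => x _.
    exact: continuous_sqdist.
  - rewrite -/((Num.Def.normr \o (fun x => z - x)) @^-1` [set t | r <= t]).
    apply: preimage_closed => [x _|]; last exact: closed_ge.
    apply: (continuous_comp _ (@norm_continuous _ _ _)).
    exact: (continuousB (@cst_continuous _ _ _ _)).
(* C may be empty, in which case any d will do *)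
have [d d0 dE] : exists2 d, 0 < d & forall x, C x -> u x <= m - d.
  have [C0|/set0P/negP] := pselect (C !=set0); last first.
    by rewrite negbK => /eqP C0; exists 1 => // x; rewrite C0.
  have [|p] := compact_EVT_max C0 cC (f := u).
    by apply: continuous_on_compact; [move=> x [[/KU]]|exact: u2.1].
  rewrite inE => Cp pmax; exists (m - u p); first by rewrite subr_gt0 uC.
  by move=> x Cx; rewrite subKr; apply: pmax; rewrite inE.
pose phi := (fun t => d * expR (- c * t)) \o sqdist y'.
have phi_gt0 x : 0 < phi x by rewrite /phi /= mulr_gt0// expR_gt0.
have phi_le x : phi x <= d.
  rewrite /phi /= -[leRHS]mulr1 ler_pM2l// expR_le1 mulNr oppr_le0.
  by rewrite mulr_ge0 ?sqdist_ge0// ltW.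
have phi2 : twice_differentiable_on setT phi.
  apply: (@twice_differentiable_comp _ _ setT _ _ (fun t => - c * d * expR (- c * t))
    (fun t => - c * (- c * d) * expR (- c * t)) openT).
  - exact: twice_differentiable_sqdist.
  - by move=> x _; exact: is_derive_scaled_exp.
  - by move=> x _; exact: is_derive_scaled_exp.
have phi2U : twice_differentiable_on U phi.
  by split=> *; [exact: phi2.1|exact: phi2.2].
pose v := u \+ phi.
have v2 : twice_differentiable_on U v by exact: twice_differentiableD.
have [p Kp vp] : exists2 p, K z r p & forall x, K z r x -> v x <= v p.
  have [||p] := compact_EVT_max _ (@compact_K z r) (f := v).
  - by exists z; rewrite /K /closed_ball_ /= subrr normr0 ltW.
  - by apply: continuous_on_compact => //; exact: v2.1.
  by rewrite inE => Kp pmax; exists p => // x Kx; apply: pmax; rewrite inE.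
have Kz : K z r z by rewrite /K /closed_ball_ /= subrr normr0 ltW.
have pr : `|z - p| < r.
  rewrite ltNge; apply/negP => rp.
  suff : v p < v z by rewrite ltNge => /negP; apply; exact: vp.
  have [pz|zp] := leP (sqdist y' p) (sqdist y' z).
    rewrite /v /= uz (@le_lt_trans _ _ m) ?ltrDl//.
    by rewrite -[leRHS](subrK d) lerD// dE.
  rewrite /v /= uz ler_ltD ?u_le//; first exact: KU.
  by rewrite /phi /= ltr_pM2l// ltr_expR ltr_nM2l// oppr_lt0.
have Up := KU _ Kp.
have : local_laplacian G v p <= 0.
  apply: (local_laplacian_max_le0 oU Up v2); [exact: G_sym|exact: G_pos|].
  have : nbhs p (ball z r).
    by apply: open_nbhs_nbhs; split; [exact: ball_open|rewrite -ball_normE].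
  by apply: filterS => x; rewrite -ball_normE => /ltW; exact: vp.
rewrite leNgt => /negP; apply.
by rewrite (local_laplacianD G oU Up)// ltr_wpDl ?u_subharmonic// KL.
Qed.

(** If u y < m with y close to x0, let z be the point of u = m nearest to y in a
    cube around x0. Both y and z being at distance less than r / 2, z is interior
    to the cube, so that z is nearest to y among all the nearby points of u = m:
    an interior sphere. *)
Lemma strong_maximum_principle x0 : U x0 -> u x0 = m -> \forall x \near x0, u x = m.
Proof.
move=> Ux0 ux0.
have nU : nbhs x0 U by exact: open_nbhs_nbhs.
have [r r0 rU] := nbhs_K nU.
have q0 : sqdist x0 x0 = 0.
  by rewrite /sqdist big1// => i _; rewrite subrr expr0n.
have nq : \forall y \near x0, sqdist x0 y < (r / 2) ^+ 2.
  apply: (cvgr_lt _ (@continuous_sqdist _ _ x0 x0)).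
  by rewrite q0 exprn_gt0// divr_gt0.
near=> y; apply/eqP/negPn/negP => uy.
have sqC a b : sqdist a b = sqdist b a :> R.
  by apply: eq_bigr => i _; rewrite -sqrrN opprB.
have qy : sqdist y x0 < (r / 2) ^+ 2 by rewrite sqC; near: y.
have close a b : sqdist a b < (r / 2) ^+ 2 -> `|b - a| < r / 2.
  move=> q; rewrite (le_lt_trans (norm_le_sqrt_sqdist _ _))//.
  rewrite -[ltRHS]gtr0_norm ?divr_gt0// -sqrtr_sqr ltr_sqrt//.
  by rewrite exprn_gt0// divr_gt0.
pose F := K x0 r `&` [set x | u x = m].
have cF : compact F.
  apply: (subclosed_compact _ (@compact_K x0 r)); last by move=> x [].
  move=> x Fx.
  have Kx : K x0 r x.
    by apply: closed_closed_ball_ => B /Fx[w [[Kw _] Bw]]; exists w.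
  split=> //=; apply/eqP; rewrite eq_le u_le /=; last exact: rU.
  rewrite leNgt; apply/negP => um.
  have uc : {for x, continuous u} by apply/differentiable_continuous/u2.1/rU.
  have /Fx[w [[_ /= ->]]] : \forall w \near x, u w < m by exact: (cvgr_lt _ uc).
  by rewrite ltxx.
have Fx0 : F x0 by split=> //; rewrite /K /closed_ball_ /= subrr normr0 ltW.
have [||z] := compact_EVT_min _ cF (f := sqdist y); first by exists x0.
  by apply: continuous_subspaceT => w; exact: continuous_sqdist.
rewrite inE => -[Kz /= uz] zmin.
have qz : sqdist y z < (r / 2) ^+ 2.
  by apply: le_lt_trans qy; apply: zmin; rewrite inE.
apply: (@no_interior_sphere y z) => //; first exact: rU.
  by apply: contraNneq uy => <-; rewrite uz.
have : nbhs z (ball x0 r).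
  apply: open_nbhs_nbhs; split; first exact: ball_open.
  rewrite -ball_normE /ball_ /= -(subrK y x0) -addrA [r]splitr.
  rewrite (le_lt_trans (ler_normD _ _))// ltrD//; first exact: close.
  by rewrite distrC; exact: close.
apply: filterS => x; rewrite -ball_normE => /ltW Kx ux.
by apply: zmin; rewrite inE.
Unshelve. all: by end_near. Qed.

End subharmonic.

End maximum_principle.

(** * Subharmonic functions on manifolds *)

Section manifolds.
Context {R : realType}.

Lemma smooth_continuous n (M : manifold R n) (u : M -> R) : smooth u -> continuous u.
Proof.
move=> su p; have [i ip] := manifold_cover p.
have uc : {for cmap (mchart i) p, continuous (u \o cinv (mchart i))}.
  by apply: differentiable_continuous; apply: (su i [::]); exact: cmap_img.
have H := continuous_comp (cmap_continuous ip) uc.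
have pE : \forall q \near p, ((u \o cinv (mchart i)) \o cmap (mchart i)) q = u q.
  have : nbhs p (cdom (mchart i)).
    by apply: open_nbhs_nbhs; split => //; exact: open_cdom.
  by apply: filterS => q iq; rewrite /= cmapK.
rewrite /continuous_at -(nbhs_singleton pE).
exact: cvg_trans (near_eq_cvg pE) H.
Qed.

(** The strong maximum principle in a chart around each point, transported by the
    continuous chart map. *)
Lemma open_argmax_subharmonic n (M : manifold R n) (g : metric M) (u : M -> R) m :
  (forall i, twice_differentiable_on (cimg (mchart i)) (u \o cinv (mchart i))) ->
  (forall i p, cdom (mchart i) p -> 0 <= laplacian g u i p) ->
  (forall p, u p <= m) -> open [set p | u p = m].
Proof.
move=> u2 u_sub u_le; rewrite openE => p /= up; have [i ip] := manifold_cover p.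
have x0 := cmap_img ip.
have H : \forall x \near cmap (mchart i) p, (u \o cinv (mchart i)) x = m.
  apply: (strong_maximum_principle (open_cimg (c := mchart i))
    (metric_smooth g (i := i)) _ _ (u2 i)) => // [x Ux|x Ux|x Ux|x _|].
  - exact: (Defs.metric_sym g (cinv_dom Ux)).
  - exact: (metric_pos g (cinv_dom Ux)).
  - by have := u_sub _ _ (cinv_dom Ux); rewrite /laplacian cinvK.
  - exact: u_le.
  - by rewrite /= cmapK.
have nd : nbhs p (cdom (mchart i)).
  by apply: open_nbhs_nbhs; split => //; exact: open_cdom.
have := cmap_continuous ip H; apply: filterS2 nd => q iq /=.
by rewrite cmapK.
Qed.

Lemma smooth_ln_twice_differentiable n (U : set 'rV[R]_n) f : open U ->
  smooth_on U f -> (forall x, U x -> 0 < f x) ->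
  twice_differentiable_on U (@ln R \o f).
Proof.
move=> oU sf f0.
apply: (@twice_differentiable_comp _ _ U f _ (fun t => t^-1) (fun t => - t ^- 2)) => //.
- exact: smooth_on_twice_differentiable.
- by move=> x /f0 fx; exact: is_derive1_ln.
move=> x /f0 fx; have fx0 : id (f x) != 0 by rewrite gt_eqF.
have := @is_deriveV R id (f x) 1 1 fx0 (is_derive_id _ _).
by rewrite [_ *: 1]mulr1.
Qed.

End manifolds.

Theorem theorem3p1 (R : realType) (n1 n2 : nat)
  (M1 : manifold R n1) (M2 : manifold R n2)
  (g1 : metric M1) (g2 : metric M2)
  (f1 : pos_smooth M1) (f2 : pos_smooth M2) :
  connected [set: M1] ->
  compact [set: M1] ->
  harmonic_on_manifold (dw_metric g1 g2 f1 f2) (fun p => ln (f1 p.1)) ->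
  warped_product_form g1 g2 f1 f2.
Proof.
move=> conM1 compM1 harm.
have f1c : continuous f1 by exact/smooth_continuous/ps_smooth.
have [||x0 _ x0max] := compact_EVT_max _ compM1 (f := f1).
- exact: manifold_nonempty.
- exact: continuous_subspaceT.
have {}x0max x : f1 x <= f1 x0 by apply: x0max; rewrite inE.
have [y _] := manifold_nonempty M2.
pose u (p : prod_manifold M1 M2) := ln (f1 p.1).
(* the maximum principle on the whole product, which need not be compact *)
have oM : open [set p | u p = ln (f1 x0)].
  apply: (open_argmax_subharmonic (g := dw_metric g1 g2 f1 f2)).
  - move=> i; apply: smooth_ln_twice_differentiable => [||x _].
    + exact: open_cimg.
    + apply: smooth_onS (smooth_on_lsubmx (@ps_smooth _ _ _ f1 i.1)).
      by move=> x [].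
    + exact: ps_gt0.
  - by move=> i p ip; rewrite harm.
  - by move=> p; rewrite ler_ln ?posrE ?ps_gt0.
have f1E : [set x | f1 x = f1 x0] = [set: M1].
  apply: conM1; first by exists x0.
  (* open in M1, as the trace of an open set of the product on a slice *)
  - exists [set x | f1 x = f1 x0]; last by rewrite setTI.
    rewrite (_ : [set x | f1 x = f1 x0] =
        (fun x => (x, y)) @^-1` [set p | u p = ln (f1 x0)]); last first.
      apply/seteqP; split => x /=; first by rewrite /u /= => ->.
      by apply: ln_inj; rewrite posrE ps_gt0.
    apply: open_comp oM => x _.
    by apply: cvg_pair => //=; exact: cvg_cst.
  - exists [set x | f1 x = f1 x0]; last by rewrite setTI.
    by apply: preimage_closed (@closed_eq _ (f1 x0)) => x _; exact: f1c.
have f1cst x : f1 x = f1 x0 by have : [set: M1] x by []; rewrite -f1E.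
exists (f1 x0), (ps_gt0 f1 x0); split => // i p ip.
rewrite /dw_metric /= /dw_tensor /prod_tensor f1cst expr1n scale1r.
by rewrite /pullback /scale_metric /= /scale_tensor -scalemxAr -scalemxAl.
Qed.
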